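(* Let $X$ be a locally finite oriented simplicial complex, $R$ a ring, and fix a degree $n$ for the local homology sheaf $h_n$ and local cohomology cosheaf $h^n$. The chain-level cap product $$C^{\mathrm{lf}}_k(X;h^n)\otimes C^l(X;h_n)\xrightarrow{\ \cap\ }C^{\mathrm{lf}}_{k-l}(X;R)$$ is a chain map with respect to the differential of the tensor product complex given by $$\partial_{\mathrm{tot}}(\eta\otimes\phi)=d\eta\otimes\phi+(-1)^{k-l}\,\eta\otimes\partial\phi,$$ where $d$ is the differential on cosheaf chains and $\partial$ the differential on sheaf cochains. The other chain-level cap products $$C^{\mathrm{lf}}_k(X;h^n)\otimes C_c^l(X;h_n)\to C_{k-l}(X;R),\quad C^{\mathrm{lf}}_k(X;h^n)\otimes C^l(X;R)\to C^{\mathrm{lf}}_{k-l}(X;h^n),\quad C^{\mathrm{lf}}_k(X;h^n)\otimes C_c^l(X;R)\to C_{k-l}(X;h^n)$$ are also chain maps with a similarly defined differential on the respective tensor product complexes.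
   Context: $R$ may be noncommutative; $\otimes=\otimes_R$. An orientation of $X$ is a total order on the vertices of each simplex such that face inclusions are order preserving. $X_k$ is the set of $k$-simplices; for $\sigma\in X_k$, $\sigma_{\langle j\rangle}$ is the face omitting the $j$-th vertex, $\sigma_{\leq j}$ the face spanned by vertices $0,\dots,j$, and $\sigma_{\geq j}$ the face spanned by vertices $j,\dots,k$. A combinatorial sheaf $\mathcal F$ is a covariant functor from the poset of simplices of $X$ to left $R$-modules, a cosheaf $\mathcal G$ a contravariant functor to right $R$-modules (here all are bimodule-valued). $C^k(X;\mathcal F)=\prod_{\sigma\in X_k}\mathcal F(\sigma)$ with differential $(\partial\phi)_\sigma=\sum_i(-1)^i\mathcal F(\sigma_{\langle i\rangle}<\sigma)\phi_{\sigma_{\langle i\rangle}}$; $C_c^k$ is the version with $\bigoplus$. $C_k(X;\mathcal G)=\bigoplus_{\sigma\in X_k}\mathcal G(\sigma)$ with differential $d$ sending $a\in\mathcal G(\sigma)$ to $\sum_i(-1)^i\mathcal G(\sigma>\sigma_{\langle i\rangle})a$; $C_k^{\mathrm{lf}}$ is the version with $\prod$. Coefficients $R$ mean the constant (co)sheaf. Let $X-\mathring{\mathrm{st}}(\sigma)$ be the subcomplex of simplices not having $\sigma$ as a face. $C_k(X,X-\mathring{\mathrm{st}}(\sigma);R)$ is free on symbols $\sigma\triangleleft\alpha$, $\alpha\in X_k$, $\alpha\geq\sigma$, and $C^k(X,X-\mathring{\mathrm{st}}(\sigma);R)$ has dual basis $\sigma\triangleleft\alpha^*$. $h_n(\sigma)=H_n(X,X-\mathring{\mathrm{st}}(\sigma);R)$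 with maps induced by $\sigma\triangleleft\alpha\mapsto\tau\triangleleft\alpha$ (zero if $\tau\not\leq\alpha$) for $\sigma<\tau$; $h^n(\sigma)=H^n(X,X-\mathring{\mathrm{st}}(\sigma);R)$ with maps induced by $\tau\triangleleft\alpha^*\mapsto\sigma\triangleleft\alpha^*$. Cap products at the chain level ($l\leq k$): for $\eta\in C_k^{\mathrm{lf}}(X;h^n)$ and $\phi\in C^l(X;h_n)$ (or $C_c^l$), $$\eta\cap\phi=\sum_{\sigma\in X_k}\langle h^n(\sigma>\sigma_{\geq k-l})\eta_\sigma,\phi_{\sigma_{\geq k-l}}\rangle\,\sigma_{\leq k-l},$$ where $\langle\cdot,\cdot\rangle\colon h^n(\sigma)\otimes h_n(\sigma)\to R$ is the evaluation pairing, given on representatives by extending $\langle\sigma\triangleleft\alpha^*,\sigma\triangleleft\beta\rangle=\delta_{\alpha,\beta}$ $R$-bilinearly. For $\psi\in C^l(X;R)$ (or $C_c^l$), $\eta\cap\psi$ is the $R$-bilinear extension (compatible with infinite sums) of $\sigma\triangleleft\alpha^*\cap\tau^*=\sigma_{\leq k-l}\triangleleft\alpha^*$ if $\sigma_{\geq k-l}=\tau$ and $0$ otherwise; i.e. $\eta\cap\psi=\sum_{\sigma\in X_k}\psi(\sigma_{\geq k-l})h^n(\sigma>\sigma_{\leq k-l})\eta_\sigma$ when $R$ is commutative. *)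

(* Defs.v *)
From HB Require Import structures.
From mathcomp Require Import all_boot all_order all_algebra finmap.
From mathcomp Require Import generic_quotient.
From mathcomp Require Import mathcomp_extra boolp classical_sets functions.
From mathcomp Require Import cardinality fsbigop.

Set Implicit Arguments.
Unset Strict Implicit.
Unset Printing Implicit Defensive.
Set Warnings "-redundant-canonical-projection,-projection-no-head-constant".

Import Order.TTheory GRing.Theory Num.Theory.
Local Open Scope quotient_scope.
Local Open Scope classical_set_scope.
Local Open Scope ring_scope.

Reserved Notation "v *:> a" (at level 40, left associativity).

(* (R, R)-bimodules: a left module [lmodType R] with a commuting right action. *)
HB.mixin Record Lmodule_isBimodule (R : pzRingType) V of GRing.Lmodule R V := {
  rscale : V -> R -> V;
  rscalerA : forall v a b, rscale (rscale v a) b = rscale v (a * b);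
  rscaler1 : forall v, rscale v 1 = v;
  rscalerDl : forall a, {morph rscale^~ a : u v / u + v};
  rscalerDr : forall v, {morph rscale v : a b / a + b};
  scaler_rscaler : forall a v b, a *: rscale v b = rscale (a *: v) b
}.

#[short(type="bimodType")]
HB.structure Definition Bimodule (R : pzRingType) :=
  {V of GRing.Lmodule R V & Lmodule_isBimodule R V}.

Notation "v *:> a" := (rscale v a) : ring_scope.

Section BimoduleTheory.
Variables (R : pzRingType) (V : bimodType R).
Lemma rscale0r (a : R) : (0 : V) *:> a = 0.
Proof. by apply: (addrI (0 *:> a)); rewrite -rscalerDl !addr0. Qed.
Lemma rscaler0 (v : V) : v *:> (0 : R) = 0.
Proof. by apply: (addrI (v *:> 0)); rewrite -rscalerDr !addr0. Qed.
Lemma rscalerN (v : V) (a : R) : (- v) *:> a = - (v *:> a).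
Proof. by apply: (addrI (v *:> a)); rewrite -rscalerDl !subrr rscale0r. Qed.
Lemma rscaler_sum (I : Type) (s : seq I) (P : pred I) (F : I -> V) (a : R) :
  (\sum_(i <- s | P i) F i) *:> a = \sum_(i <- s | P i) (F i *:> a).
Proof.
by apply: (big_morph (fun v : V => v *:> a) (rscalerDl a) (rscale0r a)).
Qed.
Lemma rscalerMn (v : V) (a : R) n : (v *+ n) *:> a = (v *:> a) *+ n.
Proof. by elim: n => [|n IH]; rewrite ?mulr0n ?rscale0r // !mulrS rscalerDl IH. Qed.
Lemma rscalerMz (v : V) (a : R) (z : int) : (v *~ z) *:> a = (v *:> a) *~ z.
Proof. by case: z => n; rewrite -?pmulrn ?NegzE ?mulrNz -?pmulrn ?rscalerN rscalerMn. Qed.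
End BimoduleTheory.

HB.instance Definition _ (R : pzRingType) :=
  Lmodule_isBimodule.Build R R^o
    (fun v a b => esym (mulrA (v : R) a b)) (@mulr1 R)
    (fun a u v => mulrDl (u : R) v a) (@mulrDr R)
    (fun a v b => mulrA a (v : R) b).

Section Homs.
Variable R : pzRingType.

Record bimodHom (U V : bimodType R) := BimodHom {
  hom_lin :> {linear U -> V};
  hom_rscale : forall u a, hom_lin (u *:> a) = hom_lin u *:> a }.

(* Balanced maps [U -> V -> W] that are linear on the outer sides. *)
Record bihom (U V W : bimodType R) := Bihom {
  bihom_fun :> U -> V -> W;
  bihomDl : forall v, {morph bihom_fun^~ v : u u' / u + u'};
  bihomDr : forall u, {morph bihom_fun u : v v' / v + v'};
  bihom_scale : forall a u v, bihom_fun (a *: u) v = a *: bihom_fun u v;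
  bihom_bal : forall u a v, bihom_fun (u *:> a) v = bihom_fun u (a *: v);
  bihom_rscale : forall u v a, bihom_fun u (v *:> a) = bihom_fun u v *:> a }.

Section BihomTheory.
Variables (U V W : bimodType R) (f : bihom U V W).
Lemma bihom0l v : f 0 v = 0.
Proof. by apply: (addrI (f 0 v)); rewrite -bihomDl !addr0. Qed.
Lemma bihom0r u : f u 0 = 0.
Proof. by apply: (addrI (f u 0)); rewrite -bihomDr !addr0. Qed.
End BihomTheory.

Section HomTheory.
Variables (U V : bimodType R) (f : bimodHom U V).
Lemma homfD x y : f (x + y) = f x + f y. Proof. exact: raddfD. Qed.
Lemma homf0 : f 0 = 0. Proof. exact: raddf0. Qed.
Lemma homfN x : f (- x) = - f x. Proof. exact: raddfN. Qed.
Lemma homfB x y : f (x - y) = f x - f y. Proof. exact: raddfB. Qed.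
Lemma homfZ a x : f (a *: x) = a *: f x. Proof. exact: linearZ. Qed.
Lemma homfR x a : f (x *:> a) = f x *:> a. Proof. exact: hom_rscale. Qed.
Lemma homf_sum (I : Type) (s : seq I) (P : pred I) (F : I -> U) :
  f (\sum_(i <- s | P i) F i) = \sum_(i <- s | P i) f (F i).
Proof. exact: raddf_sum. Qed.
Lemma homfMz x (z : int) : f (x *~ z) = f x *~ z. Proof. exact: raddfMz. Qed.
End HomTheory.

Section Mk.
Variables (U V : bimodType R) (f : U -> V).
Hypothesis fD : {morph f : x y / x + y}.
Hypothesis fZ : forall a x, f (a *: x) = a *: f x.
Hypothesis fR : forall x a, f (x *:> a) = f x *:> a.
Lemma mkHom_subproof : linear f. Proof. by move=> a x y; rewrite fD fZ. Qed.
Definition mkHom : bimodHom U V :=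
  let f' := HB.pack_for {linear U -> V} f
              (GRing.isLinear.Build R U V *:%R f mkHom_subproof) in
  @BimodHom U V f' fR.
End Mk.

Definition homId (U : bimodType R) : bimodHom U U :=
  @mkHom U U id (fun _ _ => erefl) (fun _ _ => erefl) (fun _ _ => erefl).

Definition hom0 (U V : bimodType R) : bimodHom U V.
Proof.
apply: (@mkHom U V (fun=> 0)) => [x y|a x|x a]; first by rewrite addr0.
  by rewrite scaler0.
by rewrite rscale0r.
Defined.

Definition homD (U V : bimodType R) (f g : bimodHom U V) : bimodHom U V.
Proof.
apply: (@mkHom U V (fun x => f x + g x)) => [x y|a x|x a].
- by rewrite !homfD addrACA.
- by rewrite !homfZ -scalerDr.
- by rewrite !homfR rscalerDl.
Defined.

Definition homMz (U V : bimodType R) (f : bimodHom U V) (z : int) :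
  bimodHom U V.
Proof.
apply: (@mkHom U V (fun x => f x *~ z)) => [x y|a x|x a].
- by rewrite homfD mulrzDl.
- by rewrite homfZ -scalerMzr.
- by rewrite homfR rscalerMz.
Defined.

Definition homComp (U V W : bimodType R) (g : bimodHom V W)
  (f : bimodHom U V) : bimodHom U W.
Proof.
apply: (@mkHom U W (fun x => g (f x))) => [x y|a x|x a].
- by rewrite !homfD.
- by rewrite !homfZ.
- by rewrite !homfR.
Defined.
Lemma homCompE (U V W : bimodType R) (g : bimodHom V W) (f : bimodHom U V) x :
  homComp g f x = g (f x).
Proof. by []. Qed.
Lemma homMzE (U V : bimodType R) (f : bimodHom U V) z x : homMz f z x = f x *~ z.
Proof. by []. Qed.
Lemma homDE (U V : bimodType R) (f g : bimodHom U V) x : homD f g x = f x + g x.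
Proof. by []. Qed.
End Homs.

Section DProd.
Variables (R : pzRingType) (I : Type) (M : I -> bimodType R).
Definition dprodT : Type := forall i, M i.
HB.instance Definition _ := Choice.copy dprodT (forall i, M i).

Fact dprod_addA : associative (fun x y : dprodT => (fun i => x i + y i) : dprodT).
Proof. by move=> x y z; apply: functional_extensionality_dep => i; rewrite addrA. Qed.
Fact dprod_addC : commutative (fun x y : dprodT => (fun i => x i + y i) : dprodT).
Proof. by move=> x y; apply: functional_extensionality_dep => i; rewrite addrC. Qed.
Fact dprod_add0 : left_id ((fun=> 0) : dprodT) (fun x y : dprodT => (fun i => x i + y i) : dprodT).
Proof. by move=> x; apply: functional_extensionality_dep => i; rewrite add0r. Qed.
Fact dprod_addN : left_inverse ((fun=> 0) : dprodT) (fun x : dprodT => (fun i => - x i) : dprodT)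
   (fun x y : dprodT => (fun i => x i + y i) : dprodT).
Proof. by move=> x; apply: functional_extensionality_dep => i; rewrite addNr. Qed.
HB.instance Definition _ :=
  GRing.isZmodule.Build dprodT dprod_addA dprod_addC dprod_add0 dprod_addN.

Definition dprod_scale (a : R) (x : dprodT) : dprodT := fun i => a *: x i.
Fact dprod_scaleA a b x : dprod_scale a (dprod_scale b x) = dprod_scale (a * b) x.
Proof. by apply: functional_extensionality_dep => i; rewrite /dprod_scale scalerA. Qed.
Fact dprod_scale1 : left_id 1 dprod_scale.
Proof. by move=> x; apply: functional_extensionality_dep => i; rewrite /dprod_scale scale1r. Qed.
Fact dprod_scaleDr : right_distributive dprod_scale +%R.
Proof. by move=> a x y; apply: functional_extensionality_dep => i; rewrite /dprod_scale scalerDr. Qed.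
Fact dprod_scaleDl x : {morph dprod_scale^~ x : a b / a + b}.
Proof. by move=> a b; apply: functional_extensionality_dep => i; rewrite /dprod_scale scalerDl. Qed.
HB.instance Definition _ := GRing.Zmodule_isLmodule.Build R dprodT
  dprod_scaleA dprod_scale1 dprod_scaleDr dprod_scaleDl.

Definition dprod_rscale (x : dprodT) (a : R) : dprodT := fun i => x i *:> a.
Fact dprod_rscaleA v a b : dprod_rscale (dprod_rscale v a) b = dprod_rscale v (a * b).
Proof. by apply: functional_extensionality_dep => i; rewrite /dprod_rscale rscalerA. Qed.
Fact dprod_rscale1 v : dprod_rscale v 1 = v.
Proof. by apply: functional_extensionality_dep => i; rewrite /dprod_rscale rscaler1. Qed.
Fact dprod_rscaleDl a : {morph dprod_rscale^~ a : u v / u + v}.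
Proof. by move=> x y; apply: functional_extensionality_dep => i; rewrite /dprod_rscale rscalerDl. Qed.
Fact dprod_rscaleDr v : {morph dprod_rscale v : a b / a + b}.
Proof. by move=> a b; apply: functional_extensionality_dep => i; rewrite /dprod_rscale rscalerDr. Qed.
Fact dprod_scale_rscale a v b : a *: dprod_rscale v b = dprod_rscale (a *: v) b.
Proof. by apply: functional_extensionality_dep => i; exact: scaler_rscaler. Qed.
HB.instance Definition _ := Lmodule_isBimodule.Build R dprodT
  dprod_rscaleA dprod_rscale1 dprod_rscaleDl dprod_rscaleDr dprod_scale_rscale.

Definition dprod : bimodType R := Bimodule.clone R dprodT _.

Lemma dprodDE (x y : dprod) i : (x + y) i = x i + y i. Proof. by []. Qed.
Lemma dprod0E i : (0 : dprod) i = 0. Proof. by []. Qed.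
Lemma dprodZE a (x : dprod) i : (a *: x) i = a *: x i. Proof. by []. Qed.
Lemma dprodRE a (x : dprod) i : (x *:> a) i = x i *:> a. Proof. by []. Qed.
Lemma dprod_ext (x y : dprod) : (forall i, x i = y i) -> x = y.
Proof. exact: functional_extensionality_dep. Qed.
End DProd.

Section SubBimodules.
Variable R : pzRingType.

Record bisub (M : bimodType R) := Bisub {
  bisub_pred :> M -> Prop;
  bisub0 : bisub_pred 0;
  bisubD : forall x y, bisub_pred x -> bisub_pred y -> bisub_pred (x + y);
  bisubZ : forall a x, bisub_pred x -> bisub_pred (a *: x);
  bisubR : forall a x, bisub_pred x -> bisub_pred (x *:> a) }.

Variables (M : bimodType R) (P : bisub M).

Lemma bisubN x : P x -> P (- x).
Proof. by rewrite -scaleN1r; apply: bisubZ. Qed.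

Lemma bisubB x y : P x -> P y -> P (x - y).
Proof. by move=> Px /bisubN; apply: bisubD. Qed.

Lemma bisub_sum (J : Type) (s : seq J) (Q : pred J) (F : J -> M) :
  (forall j, Q j -> P (F j)) -> P (\sum_(j <- s | Q j) F j).
Proof. by move=> PF; apply: (big_ind P); [exact: bisub0 | exact: bisubD | exact: PF]. Qed.

Definition subT : Type := {x : M | `[< P x >]}.
HB.instance Definition _ := SubChoice.on subT.

Definition subTMk (x : M) (Px : P x) : subT := Sub x (introT (asboolP _) Px).

Lemma subTMkK x Px : \val (@subTMk x Px) = x. Proof. exact: SubK. Qed.

Lemma subT_valP (x : subT) : P (\val x).
Proof. exact: (elimT (asboolP _) (valP x)). Qed.

Let sub_add (x y : subT) := subTMk (bisubD (subT_valP x) (subT_valP y)).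
Let sub_opp (x : subT) := subTMk (bisubN (subT_valP x)).
Let sub_zero := subTMk (bisub0 P).
Let sub_scale a (x : subT) := subTMk (bisubZ a (subT_valP x)).
Let sub_rscale (x : subT) a := subTMk (bisubR a (subT_valP x)).

Fact sub_addA : associative sub_add.
Proof. by move=> x y z; apply: val_inj; rewrite !subTMkK addrA. Qed.
Fact sub_addC : commutative sub_add.
Proof. by move=> x y; apply: val_inj; rewrite !subTMkK addrC. Qed.
Fact sub_add0 : left_id sub_zero sub_add.
Proof. by move=> x; apply: val_inj; rewrite !subTMkK add0r. Qed.
Fact sub_addN : left_inverse sub_zero sub_opp sub_add.
Proof. by move=> x; apply: val_inj; rewrite !subTMkK addNr. Qed.
HB.instance Definition _ :=
  GRing.isZmodule.Build subT sub_addA sub_addC sub_add0 sub_addN.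

Fact sub_scaleA a b x : sub_scale a (sub_scale b x) = sub_scale (a * b) x.
Proof. by apply: val_inj; rewrite !subTMkK scalerA. Qed.
Fact sub_scale1 : left_id 1 sub_scale.
Proof. by move=> x; apply: val_inj; rewrite !subTMkK scale1r. Qed.
Fact sub_scaleDr : right_distributive sub_scale +%R.
Proof. by move=> a x y; apply: val_inj; rewrite !subTMkK scalerDr. Qed.
Fact sub_scaleDl x : {morph sub_scale^~ x : a b / a + b}.
Proof. by move=> a b; apply: val_inj; rewrite !subTMkK scalerDl. Qed.
HB.instance Definition _ := GRing.Zmodule_isLmodule.Build R subT
  sub_scaleA sub_scale1 sub_scaleDr sub_scaleDl.

Fact sub_rscaleA x a b : sub_rscale (sub_rscale x a) b = sub_rscale x (a * b).
Proof. by apply: val_inj; rewrite !subTMkK rscalerA. Qed.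
Fact sub_rscale1 x : sub_rscale x 1 = x.
Proof. by apply: val_inj; rewrite !subTMkK rscaler1. Qed.
Fact sub_rscaleDl a : {morph sub_rscale^~ a : x y / x + y}.
Proof. by move=> x y; apply: val_inj; rewrite !subTMkK rscalerDl. Qed.
Fact sub_rscaleDr x : {morph sub_rscale x : a b / a + b}.
Proof. by move=> a b; apply: val_inj; rewrite !subTMkK rscalerDr. Qed.
Fact sub_scale_rscale a x b : a *: sub_rscale x b = sub_rscale (a *: x) b.
Proof. by apply: val_inj; rewrite !subTMkK scaler_rscaler. Qed.
HB.instance Definition _ := Lmodule_isBimodule.Build R subT
  sub_rscaleA sub_rscale1 sub_rscaleDl sub_rscaleDr sub_scale_rscale.

Definition subBimod : bimodType R := Bimodule.clone R subT _.
Definition sub_val (x : subBimod) : M := \val (x : subT).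
Definition subMk (x : M) (Px : P x) : subBimod := subTMk Px.

Lemma subMkK x Px : sub_val (@subMk x Px) = x. Proof. exact: subTMkK. Qed.
Lemma sub_valP x : P (sub_val x). Proof. exact: subT_valP. Qed.
Lemma sub_val_inj : injective sub_val.
Proof. exact: val_inj. Qed.
Lemma sub_valD : {morph sub_val : x y / x + y}.
Proof. by move=> x y; exact: subTMkK. Qed.
Lemma sub_val0 : sub_val 0 = 0.
Proof. exact: subTMkK. Qed.
Lemma sub_valZ a x : sub_val (a *: x) = a *: sub_val x.
Proof. exact: subTMkK. Qed.
Lemma sub_valR x a : sub_val (x *:> a) = sub_val x *:> a.
Proof. exact: subTMkK. Qed.
Definition sub_hom : bimodHom subBimod M := mkHom sub_valD sub_valZ sub_valR.

Definition quot_rel (x y : M) := `[< P (x - y) >].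
Fact quot_rel_equiv : equiv_class_of quot_rel.
Proof.
split=> [x|x y|y x z]; rewrite /quot_rel.
- by apply/asboolP; rewrite subrr; apply: bisub0.
- by apply: asbool_equiv_eq; split=> /bisubN; rewrite opprB.
- by move=> /asboolP h1 /asboolP h2; apply/asboolP; rewrite -(subrKA y); apply: bisubD.
Qed.
Canonical quot_rel_canonical := EquivRelPack quot_rel_equiv.
Definition quotT : Type := {eq_quot quot_rel}.
HB.instance Definition _ := Choice.on quotT.
HB.instance Definition _ := EqQuotient.on quotT.

Definition quotT_pi (x : M) : quotT := \pi_quotT x.

Lemma quotT_piP x y : quotT_pi x = quotT_pi y <-> P (x - y).
Proof.
split=> [/eqP|h]; first by rewrite /quotT_pi eqmodE => /asboolP.
by apply/eqP; rewrite /quotT_pi eqmodE; apply/asboolP.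
Qed.

Lemma quotT_ind (K : quotT -> Prop) :
  (forall x, K (quotT_pi x)) -> forall x, K x.
Proof. by move=> h x; rewrite -[x]reprK; apply: h. Qed.

Lemma repr_quotT x : P (repr (quotT_pi x) - x).
Proof. by apply/quotT_piP; rewrite /quotT_pi reprK. Qed.

Definition quot_add (x y : quotT) := quotT_pi (repr x + repr y).
Definition quot_opp (x : quotT) := quotT_pi (- repr x).
Definition quot_scale a (x : quotT) := quotT_pi (a *: repr x).
Definition quot_rscale (x : quotT) a := quotT_pi (repr x *:> a).

Lemma quot_addE x y : quot_add (quotT_pi x) (quotT_pi y) = quotT_pi (x + y).
Proof. by apply/quotT_piP; rewrite opprD addrACA; apply: bisubD; exact: repr_quotT. Qed.
Lemma quot_oppE x : quot_opp (quotT_pi x) = quotT_pi (- x).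
Proof. by apply/quotT_piP; rewrite -opprD; apply: bisubN; exact: repr_quotT. Qed.
Lemma quot_scaleE a x : quot_scale a (quotT_pi x) = quotT_pi (a *: x).
Proof. by apply/quotT_piP; rewrite -scalerBr; apply: bisubZ; exact: repr_quotT. Qed.
Lemma quot_rscaleE x a : quot_rscale (quotT_pi x) a = quotT_pi (x *:> a).
Proof.
by apply/quotT_piP; rewrite -rscalerN -rscalerDl; apply: bisubR; exact: repr_quotT.
Qed.

Fact quot_addA : associative quot_add.
Proof.
elim/quotT_ind=> x; elim/quotT_ind=> y; elim/quotT_ind=> z.
by rewrite !quot_addE addrA.
Qed.
Fact quot_addC : commutative quot_add.
Proof. by elim/quotT_ind=> x; elim/quotT_ind=> y; rewrite !quot_addE addrC. Qed.
Fact quot_add0 : left_id (quotT_pi 0) quot_add.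
Proof. by elim/quotT_ind=> x; rewrite quot_addE add0r. Qed.
Fact quot_addN : left_inverse (quotT_pi 0) quot_opp quot_add.
Proof. by elim/quotT_ind=> x; rewrite quot_oppE quot_addE addNr. Qed.
HB.instance Definition _ :=
  GRing.isZmodule.Build quotT quot_addA quot_addC quot_add0 quot_addN.

Fact quot_scaleA a b x : quot_scale a (quot_scale b x) = quot_scale (a * b) x.
Proof. by elim/quotT_ind: x => x; rewrite !quot_scaleE scalerA. Qed.
Fact quot_scale1 : left_id 1 quot_scale.
Proof. by elim/quotT_ind=> x; rewrite quot_scaleE scale1r. Qed.
Fact quot_scaleDr : right_distributive quot_scale +%R.
Proof.
move=> a; elim/quotT_ind=> x; elim/quotT_ind=> y.
by rewrite [LHS](congr1 (quot_scale a) (quot_addE x y)) !quot_scaleE scalerDr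
  [RHS]quot_addE.
Qed.
Fact quot_scaleDl x : {morph quot_scale^~ x : a b / a + b}.
Proof.
by move=> a b; elim/quotT_ind: x => x; rewrite !quot_scaleE scalerDl [RHS]quot_addE.
Qed.
HB.instance Definition _ := GRing.Zmodule_isLmodule.Build R quotT
  quot_scaleA quot_scale1 quot_scaleDr quot_scaleDl.

Fact quot_rscaleA x a b : quot_rscale (quot_rscale x a) b = quot_rscale x (a * b).
Proof. by elim/quotT_ind: x => x; rewrite !quot_rscaleE rscalerA. Qed.
Fact quot_rscale1 x : quot_rscale x 1 = x.
Proof. by elim/quotT_ind: x => x; rewrite quot_rscaleE rscaler1. Qed.
Fact quot_rscaleDl a : {morph quot_rscale^~ a : x y / x + y}.
Proof.
elim/quotT_ind=> x; elim/quotT_ind=> y.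
by rewrite [LHS](congr1 (quot_rscale^~ a) (quot_addE x y)) !quot_rscaleE rscalerDl
  [RHS]quot_addE.
Qed.
Fact quot_rscaleDr x : {morph quot_rscale x : a b / a + b}.
Proof.
by move=> a b; elim/quotT_ind: x => x; rewrite !quot_rscaleE rscalerDr [RHS]quot_addE.
Qed.
Fact quot_scale_rscale a x b : a *: quot_rscale x b = quot_rscale (a *: x) b.
Proof.
elim/quotT_ind: x => x.
by rewrite [LHS](congr1 (quot_scale a) (quot_rscaleE x b))
  [X in quot_rscale X b]quot_scaleE quot_scaleE quot_rscaleE scaler_rscaler.
Qed.
HB.instance Definition _ := Lmodule_isBimodule.Build R quotT
  quot_rscaleA quot_rscale1 quot_rscaleDl quot_rscaleDr quot_scale_rscale.

Definition quotBimod : bimodType R := Bimodule.clone R quotT _.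
Definition quot_pi (x : M) : quotBimod := quotT_pi x.
Definition quot_repr (u : quotBimod) : M := repr (u : quotT).

Lemma quot_piP x y : quot_pi x = quot_pi y <-> P (x - y).
Proof. exact: quotT_piP. Qed.
Lemma quot_reprK u : quot_pi (quot_repr u) = u.
Proof. exact: reprK. Qed.
Lemma quot_piD : {morph quot_pi : x y / x + y}.
Proof. by move=> x y; apply/esym/quot_addE. Qed.
Lemma quot_piZ a x : quot_pi (a *: x) = a *: quot_pi x.
Proof. exact/esym/quot_scaleE. Qed.
Lemma quot_piR x a : quot_pi (x *:> a) = quot_pi x *:> a.
Proof. exact/esym/quot_rscaleE. Qed.
Definition quot_hom : bimodHom M quotBimod := mkHom quot_piD quot_piZ quot_piR.
End SubBimodules.
Arguments subMk {R M} P x Px.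

Section Homology.
Variable R : pzRingType.

Definition kerBimod (U V : bimodType R) (f : bimodHom U V) : bisub U.
Proof.
exists (fun x => f x = 0) => [|x y fx fy|a x fx|a x fx].
- exact: homf0.
- by rewrite homfD fx fy addr0.
- by rewrite homfZ fx scaler0.
- by rewrite homfR fx rscale0r.
Defined.

Section Def.
Variables (A B C : bimodType R) (f : bimodHom A B) (g : bimodHom B C).

Definition bdrBimod : bisub (subBimod (kerBimod g)).
Proof.
exists (fun z => exists x, sub_val z = f x).
- by exists 0; rewrite sub_val0 homf0.
- by move=> ? ? [x ex] [y ey]; exists (x + y); rewrite sub_valD ex ey homfD.
- by move=> a ? [x ex]; exists (a *: x); rewrite sub_valZ ex homfZ.
- by move=> a ? [x ex]; exists (x *:> a); rewrite sub_valR ex homfR.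
Defined.

(* ker g / (ker g \cap im f) *)
Definition homology : bimodType R := quotBimod bdrBimod.

Definition hclass (x : B) (gx : g x = 0) : homology :=
  quot_pi bdrBimod (subMk (kerBimod g) x gx).

Definition hrepr (u : homology) : B := sub_val (quot_repr u).

Lemma hreprP u : g (hrepr u) = 0. Proof. exact: (sub_valP (quot_repr u)). Qed.

Lemma hclass_eq x y gx gy :
  @hclass x gx = @hclass y gy <-> exists z, x - y = f z.
Proof.
split=> [/quot_piP [z]|[z e]].
  by rewrite sub_valD -scaleN1r sub_valZ !subMkK scaleN1r => e; exists z.
by apply/quot_piP; exists z; rewrite sub_valD -scaleN1r sub_valZ !subMkK scaleN1r.
Qed.

Lemma hclassK u : hclass (hreprP u) = u.
Proof.
rewrite /hclass -[RHS]quot_reprK; congr (quot_pi _ _); apply: sub_val_inj.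
by rewrite subMkK.
Qed.

Lemma hreprK x gx : exists z, hrepr (@hclass x gx) - x = f z.
Proof. exact: (proj1 (hclass_eq (hreprP _) gx) (hclassK _)). Qed.
Lemma hclass_ext x y gx gy : x = y -> @hclass x gx = @hclass y gy.
Proof. by move=> e; apply/hclass_eq; exists 0; rewrite homf0 e subrr. Qed.

Lemma hclass_ind (K : homology -> Prop) :
  (forall x gx, K (@hclass x gx)) -> forall u, K u.
Proof. by move=> h u; rewrite -(hclassK u); apply: h. Qed.

Lemma hclassD x y gx gy gxy :
  @hclass x gx + @hclass y gy = @hclass (x + y) gxy.
Proof.
by rewrite /hclass -quot_piD; congr (quot_pi _ _); apply: sub_val_inj; rewrite sub_valD !subMkK.
Qed.
Lemma hclassZ a x gx gax : a *: @hclass x gx = @hclass (a *: x) gax.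
Proof.
by rewrite /hclass -quot_piZ; congr (quot_pi _ _); apply: sub_val_inj; rewrite sub_valZ !subMkK.
Qed.
Lemma hclassR a x gx gax : @hclass x gx *:> a = @hclass (x *:> a) gax.
Proof.
by rewrite /hclass -quot_piR; congr (quot_pi _ _); apply: sub_val_inj; rewrite sub_valR !subMkK.
Qed.
Lemma hreprD u v : exists z, hrepr (u + v) - (hrepr u + hrepr v) = f z.
Proof.
have h : g (hrepr u + hrepr v) = 0 by rewrite homfD !hreprP addr0.
have [z e] := hreprK h; exists z; rewrite -e; congr (hrepr _ - _).
by rewrite -[u in LHS]hclassK -[v in LHS]hclassK; apply: hclassD.
Qed.
Lemma hreprZ a u : exists z, hrepr (a *: u) - (a *: hrepr u) = f z.
Proof.
have h : g (a *: hrepr u) = 0 by rewrite homfZ !hreprP scaler0.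
have [z e] := hreprK h; exists z; rewrite -e; congr (hrepr _ - _).
by rewrite -[u in LHS]hclassK; apply: hclassZ.
Qed.
Lemma hreprR a u : exists z, hrepr (u *:> a) - (hrepr u *:> a) = f z.
Proof.
have h : g (hrepr u *:> a) = 0 by rewrite homfR !hreprP rscale0r.
have [z e] := hreprK h; exists z; rewrite -e; congr (hrepr _ - _).
by rewrite -[u in LHS]hclassK; apply: hclassR.
Qed.
End Def.

Section Map.
Variables (A B C A' B' C' : bimodType R).
Variables (f : bimodHom A B) (g : bimodHom B C).
Variables (f' : bimodHom A' B') (g' : bimodHom B' C').
Variables (a : bimodHom A A') (b : bimodHom B B') (c : bimodHom C C').
Hypothesis bf : forall x, b (f x) = f' (a x).
Hypothesis cg : forall x, c (g x) = g' (b x).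

Fact hmap_subproof u : g' (b (hrepr (u : homology f g))) = 0.
Proof. by rewrite -cg hreprP homf0. Qed.

Definition hmap_fun (u : homology f g) : homology f' g' :=
  hclass f' (hmap_subproof u).

Fact hmapD : {morph hmap_fun : u v / u + v}.
Proof.
move=> u v; have h : g' (b (hrepr u) + b (hrepr v)) = 0.
  by rewrite homfD !hmap_subproof addr0.
rewrite /hmap_fun (hclassD _ _ _ h); apply/hclass_eq; have [z e] := hreprD u v.
by exists (a z); rewrite -bf -e homfB !homfD.
Qed.
Fact hmapZ r u : hmap_fun (r *: u) = r *: hmap_fun u.
Proof.
have h : g' (r *: b (hrepr u)) = 0 by rewrite homfZ hmap_subproof scaler0.
rewrite /hmap_fun (hclassZ _ _ h); apply/hclass_eq; have [z e] := hreprZ r u.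
by exists (a z); rewrite -bf -e homfB homfZ.
Qed.
Fact hmapR u r : hmap_fun (u *:> r) = hmap_fun u *:> r.
Proof.
have h : g' (b (hrepr u) *:> r) = 0 by rewrite homfR hmap_subproof rscale0r.
rewrite /hmap_fun (hclassR _ _ h); apply/hclass_eq; have [z e] := hreprR r u.
by exists (a z); rewrite -bf -e homfB homfR.
Qed.
Definition hmap : bimodHom (homology f g) (homology f' g') :=
  mkHom hmapD hmapZ hmapR.

Lemma hmapE x gx gbx : hmap (@hclass _ _ _ f g x gx) = @hclass _ _ _ f' g' (b x) gbx.
Proof.
apply/hclass_eq; have [z e] := hreprK f gx.
by exists (a z); rewrite -bf -e homfB.
Qed.
End Map.
End Homology.

Section DSum.
Variables (R : pzRingType) (I : choiceType) (M : I -> bimodType R).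

Definition supp (x : dprod M) : set I := [set i | x i != 0].

Definition finsupp : bisub (dprod M).
Proof.
exists (fun x => finite_set (supp x)).
- by apply: (sub_finite_set _ (finite_set0 I)) => i; rewrite /supp /= dprod0E eqxx.
- move=> x y fx fy.
  have fxy : finite_set (supp x `|` supp y) by rewrite finite_setU.
  apply: (sub_finite_set _ fxy) => i; rewrite /supp /= dprodDE.
  have [->|] := eqVneq (x i) 0; last by left.
  by rewrite add0r; right.
- move=> a x; apply: sub_finite_set => i; rewrite /supp /= dprodZE.
  by apply: contra_neq => ->; rewrite scaler0.
- move=> a x; apply: sub_finite_set => i; rewrite /supp /= dprodRE.
  by apply: contra_neq => ->; rewrite rscale0r.
Defined.

Definition dsum : bimodType R := subBimod finsupp.

Definition dsum_coef (x : dsum) : dprod M := sub_val x.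

Lemma dsum_fin (x : dsum) : finite_set (supp (dsum_coef x)).
Proof. exact: (sub_valP x). Qed.

Lemma dsum_coefD x y i : dsum_coef (x + y) i = dsum_coef x i + dsum_coef y i.
Proof. by rewrite /dsum_coef sub_valD. Qed.
Lemma dsum_coefZ a x i : dsum_coef (a *: x) i = a *: dsum_coef x i.
Proof. by rewrite /dsum_coef sub_valZ. Qed.
Lemma dsum_coefR x a i : dsum_coef (x *:> a) i = dsum_coef x i *:> a.
Proof. by rewrite /dsum_coef sub_valR. Qed.
Lemma dsum_coef0 i : dsum_coef 0 i = 0.
Proof. by rewrite /dsum_coef sub_val0. Qed.
Lemma dsum_coef_sum (J : Type) (s : seq J) (P : pred J) (F : J -> dsum) i :
  dsum_coef (\sum_(j <- s | P j) F j) i = \sum_(j <- s | P j) dsum_coef (F j) i.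
Proof.
by apply: (big_morph (fun x => dsum_coef x i)) => [x y|]; rewrite ?dsum_coefD ?dsum_coef0.
Qed.

Lemma dsum_ext x y : (forall i, dsum_coef x i = dsum_coef y i) -> x = y.
Proof.
by move=> h; apply: sub_val_inj; apply: dprod_ext => i; apply: h.
Qed.

Definition dirac i (m : M i) : dprod M := fun j =>
  if i =P j is ReflectT e then ecast k (M k) e m else 0.

Lemma diracE i (m : M i) : dirac m i = m.
Proof. by rewrite /dirac; case: eqP => // e; rewrite eq_axiomK. Qed.
Lemma dirac_neq i (m : M i) j : i != j -> dirac m j = 0.
Proof. by rewrite /dirac; case: eqP. Qed.

Fact dirac_fin i (m : M i) : finsupp (dirac m).
Proof.
apply: (sub_finite_set _ (finite_set1 i)) => j; rewrite /supp /=.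
by apply: contra_neqP => /eqP; rewrite eq_sym => ij; rewrite dirac_neq.
Qed.

Definition dsum_in_fun i (m : M i) : dsum := subMk finsupp (dirac m) (dirac_fin m).

Lemma dsum_inE i (m : M i) : dsum_coef (dsum_in_fun m) = dirac m.
Proof. exact: subMkK. Qed.

Fact dsum_inD i : {morph @dsum_in_fun i : x y / x + y}.
Proof.
move=> x y; apply: dsum_ext => j; rewrite dsum_coefD !dsum_inE.
have [<-|ij] := eqVneq i j; first by rewrite !diracE.
by rewrite !dirac_neq ?addr0.
Qed.
Fact dsum_inZ i a x : @dsum_in_fun i (a *: x) = a *: dsum_in_fun x.
Proof.
apply: dsum_ext => j; rewrite dsum_coefZ !dsum_inE.
have [<-|ij] := eqVneq i j; first by rewrite !diracE.
by rewrite !dirac_neq ?scaler0.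
Qed.
Fact dsum_inR i x a : @dsum_in_fun i (x *:> a) = dsum_in_fun x *:> a.
Proof.
apply: dsum_ext => j; rewrite dsum_coefR !dsum_inE.
have [<-|ij] := eqVneq i j; first by rewrite !diracE.
by rewrite !dirac_neq ?rscale0r.
Qed.
Definition dsum_in i : bimodHom (M i) dsum :=
  mkHom (@dsum_inD i) (@dsum_inZ i) (@dsum_inR i).

Section Lift.
Variables (N : bimodType R) (f : forall i, bimodHom (M i) N).
Definition dsum_lift_fun (x : dsum) : N :=
  \sum_(i \in [set: I]) f i (dsum_coef x i).

Lemma dsum_liftE (A : set I) x : supp (dsum_coef x) `<=` A ->
  dsum_lift_fun x = \sum_(i \in A) f i (dsum_coef x i).
Proof.
move=> sA; apply/esym/fsbig_widen => // i [_ /= nA].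
have [->|h] := eqVneq (dsum_coef x i) 0; first exact: homf0.
by case: nA; apply: sA.
Qed.

Fact dsum_liftD : {morph dsum_lift_fun : x y / x + y}.
Proof.
move=> x y; set A := supp (dsum_coef x) `|` supp (dsum_coef y).
have fA : finite_set A by rewrite finite_setU; split; exact: dsum_fin.
rewrite (@dsum_liftE A x) ?(@dsum_liftE A y) ?(@dsum_liftE A (x + y)).
- rewrite -fsbig_split //; apply: eq_fsbigr => i _.
  by rewrite dsum_coefD homfD.
- move=> i; rewrite /supp /A /supp /= dsum_coefD.
  have [->|] := eqVneq (dsum_coef x i) 0; last by left.
  by rewrite add0r; right.
- by move=> i; right.
- by move=> i; left.
Qed.
Fact dsum_liftZ a x : dsum_lift_fun (a *: x) = a *: dsum_lift_fun x.
Proof.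
rewrite (@dsum_liftE (supp (dsum_coef x)) x) // (@dsum_liftE (supp (dsum_coef x))).
  rewrite !(fsbig_finite _ _ (dsum_fin x)) scaler_sumr; apply: eq_bigr => i _.
  by rewrite dsum_coefZ homfZ.
by move=> i; rewrite /supp /= dsum_coefZ; apply: contra_neq => ->; rewrite scaler0.
Qed.
Fact dsum_liftR x a : dsum_lift_fun (x *:> a) = dsum_lift_fun x *:> a.
Proof.
rewrite (@dsum_liftE (supp (dsum_coef x)) x) // (@dsum_liftE (supp (dsum_coef x))).
  rewrite !(fsbig_finite _ _ (dsum_fin x)) rscaler_sum; apply: eq_bigr => i _.
  by rewrite dsum_coefR homfR.
by move=> i; rewrite /supp /= dsum_coefR; apply: contra_neq => ->; rewrite rscale0r.
Qed.
Definition dsum_lift : bimodHom dsum N := mkHom dsum_liftD dsum_liftZ dsum_liftR.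

Lemma dsum_lift_in i (m : M i) : dsum_lift (dsum_in i m) = f i m.
Proof.
rewrite [LHS](@dsum_liftE [set i]) => [|j].
  by rewrite fsbig_set1 dsum_inE diracE.
rewrite /supp /= dsum_inE; apply: contra_neqP => /eqP; rewrite eq_sym => ij.
exact: dirac_neq.
Qed.
End Lift.

Lemma dsum_expand (x : dsum) :
  x = \sum_(i <- fset_set (supp (dsum_coef x))) dsum_in i (dsum_coef x i).
Proof.
apply: dsum_ext => j; rewrite dsum_coef_sum.
have [xj|xj] := eqVneq (dsum_coef x j) 0.
  rewrite xj big1_seq // => i /andP[_ ix]; rewrite [dsum_coef _]dsum_inE.
  have [ij|ij] := eqVneq i j; last by rewrite dirac_neq.
  by move: ix; rewrite in_fset_set ?inE ?ij; [rewrite /supp /= xj eqxx | exact: dsum_fin].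
rewrite (bigD1_seq j) ?fset_uniq //=; last by rewrite in_fset_set ?inE //; exact: dsum_fin.
rewrite [dsum_coef (dsum_in _ _)]dsum_inE diracE big1 ?addr0 // => i ij.
by rewrite [dsum_coef _]dsum_inE dirac_neq.
Qed.

Lemma dsum_ind (K : dsum -> Prop) : K 0 ->
  (forall x y, K x -> K y -> K (x + y)) ->
  (forall i m, K (dsum_in i m)) -> forall x, K x.
Proof. by move=> K0 KD Ki x; rewrite (dsum_expand x); apply: (big_ind K). Qed.
End DSum.

Section Tensor.
Variables (R : pzRingType) (M N : bimodType R).

(* The congruence on formal sums of pairs generated by the tensor relations. *)
Inductive tens_rel : seq (M * N) -> seq (M * N) -> Prop :=
| tens_refl s : tens_rel s s
| tens_sym s t : tens_rel s t -> tens_rel t s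
| tens_trans s t u : tens_rel s t -> tens_rel t u -> tens_rel s u
| tens_cat s s' t t' : tens_rel s s' -> tens_rel t t' ->
    tens_rel (s ++ t) (s' ++ t')
| tens_comm s t : tens_rel (s ++ t) (t ++ s)
| tens_0l n : tens_rel [:: (0, n)] [::]
| tens_0r m : tens_rel [:: (m, 0)] [::]
| tens_Dl m m' n : tens_rel [:: (m + m', n)] [:: (m, n); (m', n)]
| tens_Dr m n n' : tens_rel [:: (m, n + n')] [:: (m, n); (m, n')]
| tens_bal m a n : tens_rel [:: (m *:> a, n)] [:: (m, a *: n)].

Definition tens_relb s t := `[< tens_rel s t >].
Fact tens_relb_equiv : equiv_class_of tens_relb.
Proof.
split=> [s|s t|t s u]; rewrite /tens_relb.
- by apply/asboolP; apply: tens_refl.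
- by apply: asbool_equiv_eq; split; apply: tens_sym.
- by move=> /asboolP h1 /asboolP h2; apply/asboolP; apply: tens_trans h1 h2.
Qed.
Canonical tens_relb_canonical := EquivRelPack tens_relb_equiv.

Definition tensT : Type := {eq_quot tens_relb}.
HB.instance Definition _ := Choice.on tensT.
HB.instance Definition _ := EqQuotient.on tensT.

Definition tens_pi (s : seq (M * N)) : tensT := \pi_tensT s.

Lemma tens_piP s t : tens_pi s = tens_pi t <-> tens_rel s t.
Proof.
split=> [/eqP|h]; first by rewrite /tens_pi eqmodE => /asboolP.
by apply/eqP; rewrite /tens_pi eqmodE; apply/asboolP.
Qed.
Lemma tens_pi_ind (K : tensT -> Prop) :
  (forall s, K (tens_pi s)) -> forall x, K x.
Proof. by move=> h x; rewrite -[x]reprK; apply: h. Qed.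
Lemma repr_tens s : tens_rel (repr (tens_pi s)) s.
Proof. by apply/tens_piP; rewrite /tens_pi reprK. Qed.

Lemma tens_rel_map (f : M -> M) (g : N -> N) (h : M * N -> M * N) :
  (forall p, h p = (f p.1, g p.2)) ->
  f 0 = 0 -> g 0 = 0 -> {morph f : x y / x + y} -> {morph g : x y / x + y} ->
  (forall x a, f (x *:> a) = f x *:> a) -> (forall x a, g (a *: x) = a *: g x) ->
  forall s t, tens_rel s t -> tens_rel (map h s) (map h t).
Proof.
move=> hE f0 g0 fD gD fR gZ s t; elim=> {s t} /=.
- by move=> s; apply: tens_refl.
- by move=> s t _; apply: tens_sym.
- by move=> s t u _ + _; apply: tens_trans.
- by move=> s s' t t' _ + _ +; rewrite !map_cat; apply: tens_cat.
- by move=> s t; rewrite !map_cat; apply: tens_comm.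
- by move=> n; rewrite hE /= f0; apply: tens_0l.
- by move=> n; rewrite hE /= g0; apply: tens_0r.
- by move=> m m' n; rewrite !hE /= fD; apply: tens_Dl.
- by move=> m m' n; rewrite !hE /= gD; apply: tens_Dr.
- by move=> m a n; rewrite !hE /= fR gZ; apply: tens_bal.
Qed.

Let mapN (s : seq (M * N)) := [seq (- p.1, p.2) | p <- s].
Let mapL a (s : seq (M * N)) := [seq (a *: p.1, p.2) | p <- s].
Let mapR a (s : seq (M * N)) := [seq (p.1, p.2 *:> a) | p <- s].

Let mapN_rel s t : tens_rel s t -> tens_rel (mapN s) (mapN t).
Proof.
apply: (@tens_rel_map -%R id) => //; first exact: oppr0; first exact: opprD.
by move=> x a; rewrite rscalerN.
Qed.
Let mapL_rel a s t : tens_rel s t -> tens_rel (mapL a s) (mapL a t).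
Proof.
apply: (@tens_rel_map ( *:%R a) id) => //; first exact: scaler0; first exact: scalerDr.
by move=> x b; rewrite scaler_rscaler.
Qed.
Let mapR_rel a s t : tens_rel s t -> tens_rel (mapR a s) (mapR a t).
Proof.
apply: (@tens_rel_map id (fun n => n *:> a)) => //; first exact: rscale0r.
  exact: rscalerDl.
by move=> x b; rewrite scaler_rscaler.
Qed.

Definition tens_add (x y : tensT) := tens_pi (repr x ++ repr y).
Definition tens_opp (x : tensT) := tens_pi (mapN (repr x)).
Definition tens_scale a (x : tensT) := tens_pi (mapL a (repr x)).
Definition tens_rscale (x : tensT) a := tens_pi (mapR a (repr x)).

Lemma tens_addE s t : tens_add (tens_pi s) (tens_pi t) = tens_pi (s ++ t).
Proof. by apply/tens_piP/tens_cat; exact: repr_tens. Qed.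
Lemma tens_oppE s : tens_opp (tens_pi s) = tens_pi (mapN s).
Proof. by apply/tens_piP/mapN_rel; exact: repr_tens. Qed.
Lemma tens_scaleE a s : tens_scale a (tens_pi s) = tens_pi (mapL a s).
Proof. by apply/tens_piP/mapL_rel; exact: repr_tens. Qed.
Lemma tens_rscaleE s a : tens_rscale (tens_pi s) a = tens_pi (mapR a s).
Proof. by apply/tens_piP/mapR_rel; exact: repr_tens. Qed.

Fact tens_addA : associative tens_add.
Proof.
elim/tens_pi_ind=> x; elim/tens_pi_ind=> y; elim/tens_pi_ind=> z.
by rewrite !tens_addE catA.
Qed.
Fact tens_addC : commutative tens_add.
Proof.
elim/tens_pi_ind=> x; elim/tens_pi_ind=> y; rewrite !tens_addE.
exact/tens_piP/tens_comm.
Qed.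
Fact tens_add0 : left_id (tens_pi [::]) tens_add.
Proof. by elim/tens_pi_ind=> x; rewrite tens_addE. Qed.
Fact tens_addN : left_inverse (tens_pi [::]) tens_opp tens_add.
Proof.
elim/tens_pi_ind=> s; rewrite tens_oppE.
elim: s => [|[m n] s IH]; first by rewrite tens_addE.
have -> : tens_pi ((m, n) :: s) = tens_add (tens_pi [:: (m, n)]) (tens_pi s).
  by rewrite tens_addE.
have -> : tens_pi (mapN ((m, n) :: s)) =
    tens_add (tens_pi (mapN s)) (tens_pi [:: (- m, n)]).
  by rewrite tens_addC tens_addE.
rewrite -tens_addA [X in tens_add _ X]tens_addA.
suff -> : tens_add (tens_pi [:: (- m, n)]) (tens_pi [:: (m, n)]) = tens_pi [::].
  by rewrite tens_add0.
rewrite tens_addE; apply/tens_piP; apply: tens_trans (tens_0l n).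
by apply: tens_sym; rewrite -(addNr m); apply: tens_Dl.
Qed.
HB.instance Definition _ :=
  GRing.isZmodule.Build tensT tens_addA tens_addC tens_add0 tens_addN.

Lemma tens_piD s t : tens_pi (s ++ t) = tens_pi s + tens_pi t.
Proof. by rewrite [RHS]tens_addE. Qed.
Lemma tens_pi_nil : tens_pi [::] = 0. Proof. by []. Qed.

Definition tensorT (m : M) (n : N) : tensT := tens_pi [:: (m, n)].

Lemma tens_pi_sum s : tens_pi s = \sum_(p <- s) tensorT p.1 p.2.
Proof.
elim: s => [|p s IH]; first by rewrite big_nil.
by rewrite big_cons -IH -tens_piD /=; case: p.
Qed.

Lemma tensT_ind (K : tensT -> Prop) : K 0 -> (forall x y, K x -> K y -> K (x + y)) ->
  (forall m n, K (tensorT m n)) -> forall x, K x.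
Proof.
move=> K0 KD Kt; elim/tens_pi_ind=> s; rewrite tens_pi_sum.
by apply: (big_ind K).
Qed.

Lemma tensorTDl n : {morph tensorT^~ n : m m' / m + m'}.
Proof. by move=> m m'; rewrite -tens_piD; apply/tens_piP/tens_Dl. Qed.
Lemma tensorTDr m : {morph tensorT m : n n' / n + n'}.
Proof. by move=> n n'; rewrite -tens_piD; apply/tens_piP/tens_Dr. Qed.
Lemma tensorT_bal m a n : tensorT (m *:> a) n = tensorT m (a *: n).
Proof. exact/tens_piP/tens_bal. Qed.

Fact tens_scaleDr : right_distributive tens_scale +%R.
Proof.
move=> a; elim/tens_pi_ind=> x; elim/tens_pi_ind=> y.
by rewrite -tens_piD !tens_scaleE /mapL map_cat tens_piD.
Qed.
Fact tens_scale_tensorT a m n : tens_scale a (tensorT m n) = tensorT (a *: m) n.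
Proof. by rewrite tens_scaleE. Qed.
Fact tens_scale0 a : tens_scale a 0 = 0.
Proof. by rewrite tens_scaleE. Qed.
Fact tens_scaleA a b x : tens_scale a (tens_scale b x) = tens_scale (a * b) x.
Proof.
elim/tensT_ind: x => [|x y hx hy|m n]; first by rewrite !tens_scale0.
  by rewrite !tens_scaleDr hx hy.
by rewrite !tens_scale_tensorT scalerA.
Qed.
Fact tens_scale1 : left_id 1 tens_scale.
Proof.
elim/tensT_ind=> [|x y hx hy|m n]; first by rewrite !tens_scale0.
  by rewrite !tens_scaleDr hx hy.
by rewrite !tens_scale_tensorT scale1r.
Qed.
Fact tens_scaleDl x : {morph tens_scale^~ x : a b / a + b}.
Proof.
move=> a b; elim/tensT_ind: x => [|x y hx hy|m n]; first by rewrite !tens_scale0 addr0.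
  by rewrite !tens_scaleDr hx hy addrACA.
by rewrite !tens_scale_tensorT scalerDl tensorTDl.
Qed.
HB.instance Definition _ := GRing.Zmodule_isLmodule.Build R tensT
  tens_scaleA tens_scale1 tens_scaleDr tens_scaleDl.

Fact tens_rscaleDl a : {morph tens_rscale^~ a : x y / x + y}.
Proof.
elim/tens_pi_ind=> x; elim/tens_pi_ind=> y.
by rewrite -tens_piD !tens_rscaleE /mapR map_cat tens_piD.
Qed.
Fact tens_rscale_tensorT a m n : tens_rscale (tensorT m n) a = tensorT m (n *:> a).
Proof. by rewrite tens_rscaleE. Qed.
Fact tens_rscale0 a : tens_rscale 0 a = 0.
Proof. by rewrite tens_rscaleE. Qed.
Fact tens_rscaleA x a b : tens_rscale (tens_rscale x a) b = tens_rscale x (a * b).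
Proof.
elim/tensT_ind: x => [|x y hx hy|m n]; first by rewrite !tens_rscale0.
  by rewrite !tens_rscaleDl hx hy.
by rewrite !tens_rscale_tensorT rscalerA.
Qed.
Fact tens_rscale1 x : tens_rscale x 1 = x.
Proof.
elim/tensT_ind: x => [|x y hx hy|m n]; first by rewrite !tens_rscale0.
  by rewrite !tens_rscaleDl hx hy.
by rewrite !tens_rscale_tensorT rscaler1.
Qed.
Fact tens_rscaleDr x : {morph tens_rscale x : a b / a + b}.
Proof.
move=> a b; elim/tensT_ind: x => [|x y hx hy|m n]; first by rewrite !tens_rscale0 addr0.
  by rewrite !tens_rscaleDl hx hy addrACA.
by rewrite !tens_rscale_tensorT rscalerDr tensorTDr.
Qed.
Fact tens_scale_rscale a x b : a *: tens_rscale x b = tens_rscale (a *: x) b.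
Proof.
elim/tensT_ind: x => [|x y hx hy|m n].
- by rewrite tens_rscale0 !scaler0 tens_rscale0.
- by rewrite tens_rscaleDl !scalerDr hx hy tens_rscaleDl.
rewrite -[a *: tensorT m n]/(tens_scale a (tensorT m n)) tens_rscale_tensorT.
by rewrite [LHS]tens_scale_tensorT tens_scale_tensorT tens_rscale_tensorT.
Qed.
HB.instance Definition _ := Lmodule_isBimodule.Build R tensT
  tens_rscaleA tens_rscale1 tens_rscaleDl tens_rscaleDr tens_scale_rscale.

Definition tens : bimodType R := Bimodule.clone R tensT _.

Definition tensor (m : M) (n : N) : tens := tensorT m n.

Lemma tens_ind (K : tens -> Prop) : K 0 ->
  (forall x y, K x -> K y -> K (x + y)) ->
  (forall m n, K (tensor m n)) -> forall x, K x.
Proof. exact: tensT_ind. Qed.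
Lemma tensorDl n : {morph tensor^~ n : m m' / m + m'}.
Proof. exact: tensorTDl. Qed.
Lemma tensorDr m : {morph tensor m : n n' / n + n'}.
Proof. exact: tensorTDr. Qed.
Lemma tensor_bal m a n : tensor (m *:> a) n = tensor m (a *: n).
Proof. exact: tensorT_bal. Qed.
Lemma tensorZ a m n : tensor (a *: m) n = a *: tensor m n.
Proof. exact/esym/tens_scale_tensorT. Qed.
Lemma tensorR m n a : tensor m (n *:> a) = tensor m n *:> a.
Proof. exact/esym/tens_rscale_tensorT. Qed.

Definition tensor_bihom : bihom M N tens :=
  Bihom tensorDl tensorDr tensorZ tensor_bal tensorR.

Section Lift.
Variables (W : bimodType R) (f : bihom M N W).

Fact tens_lift_rel s t : tens_rel s t ->
  \sum_(p <- s) f p.1 p.2 = \sum_(p <- t) f p.1 p.2.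
Proof.
elim=> {s t} //=.
- by move=> s t u _ -> _ ->.
- by move=> s s' t t' _ hs _ ht; rewrite !big_cat hs ht.
- by move=> s t; rewrite !big_cat /= addrC.
- by move=> n; rewrite big_seq1 big_nil bihom0l.
- by move=> m; rewrite big_seq1 big_nil bihom0r.
- by move=> m m' n; rewrite !(big_cons, big_nil) addr0 bihomDl addr0.
- by move=> m n n'; rewrite !(big_cons, big_nil) addr0 bihomDr addr0.
- by move=> m a n; rewrite !big_seq1 bihom_bal.
Qed.

Definition tens_lift_fun (x : tens) : W :=
  \sum_(p <- repr (x : tensT)) f p.1 p.2.

Lemma tens_lift_pi s : tens_lift_fun (tens_pi s) = \sum_(p <- s) f p.1 p.2.
Proof. exact/tens_lift_rel/repr_tens. Qed.
Fact tens_liftD : {morph tens_lift_fun : x y / x + y}.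
Proof.
elim/tens_pi_ind=> s; elim/tens_pi_ind=> t.
by rewrite [tens_pi s + tens_pi t]tens_addE !tens_lift_pi big_cat.
Qed.
Fact tens_liftZ a x : tens_lift_fun (a *: x) = a *: tens_lift_fun x.
Proof.
elim/tens_pi_ind: x => s; rewrite [a *: tens_pi s]tens_scaleE !tens_lift_pi.
by rewrite big_map scaler_sumr; apply: eq_bigr => p _; rewrite bihom_scale.
Qed.
Fact tens_liftR x a : tens_lift_fun (x *:> a) = tens_lift_fun x *:> a.
Proof.
elim/tens_pi_ind: x => s; rewrite [tens_pi s *:> a]tens_rscaleE !tens_lift_pi.
by rewrite big_map rscaler_sum; apply: eq_bigr => p _; rewrite bihom_rscale.
Qed.
Definition tens_lift : bimodHom tens W := mkHom tens_liftD tens_liftZ tens_liftR.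

Lemma tens_lift_tensor m n : tens_lift (tensor m n) = f m n.
Proof. by rewrite [LHS]tens_lift_pi big_seq1. Qed.
End Lift.
End Tensor.

Definition tens_map (R : pzRingType) (M M' N N' : bimodType R)
  (f : bimodHom M M') (g : bimodHom N N') : bimodHom (tens M N) (tens M' N').
Proof.
apply: tens_lift; exists (fun m n => tensor (f m) (g n)).
- by move=> n m m'; rewrite homfD tensorDl.
- by move=> m n n'; rewrite homfD tensorDr.
- by move=> a m n; rewrite homfZ tensorZ.
- by move=> m a n; rewrite homfR tensor_bal homfZ.
- by move=> m n a; rewrite homfR tensorR.
Defined.

(* Locally finite oriented simplicial complexes.  The orientation is a total  *)
(* order [vle s] on the vertices of every simplex [s], compatible with faces. *)
Record lfComplex (V : choiceType) := LfComplex {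
  faces :> {pred {fset V}};
  faces_neq0 : fset0 \notin faces;
  faces_sub : forall s t, s \in faces -> (t `<=` s)%fset -> t != fset0 ->
    t \in faces;
  faces_fin : forall v, finite_set [set s | s \in faces /\ v \in s];
  vle : {fset V} -> rel V;
  vle_total : forall s, s \in faces -> {in s &, total (vle s)};
  vle_anti : forall s, s \in faces -> {in s &, antisymmetric (vle s)};
  vle_trans : forall s, s \in faces -> {in s & &, transitive (vle s)};
  vle_sub : forall s t, s \in faces -> t \in faces -> (t `<=` s)%fset ->
    {in t &, vle t =2 vle s} }.

Section Simplices.
Variables (V : choiceType) (X : lfComplex V).

Definition simplex : Type := {s : {fset V} | s \in faces X}.
HB.instance Definition _ := SubChoice.on simplex.

Implicit Types s t u : simplex.

Definition sdim s : nat := #|` \val s|.-1.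
Definition sle s t : bool := (\val s `<=` \val t)%fset.

Lemma sle_refl s : sle s s. Proof. exact: fsubset_refl. Qed.
Lemma sle_trans s t u : sle s t -> sle t u -> sle s u.
Proof. exact: fsubset_trans. Qed.

(* The vertices of [s] in increasing order *)
Definition verts s : seq V := sort (vle X (\val s)) (enum_fset (\val s)).

(* The face of [s] with vertex set [r], or [s] itself if [r] spans no simplex; *)
(* below this default only arises for [face s 0] with [sdim s = 0] and for      *)
(* [back s j] with [sdim s < j].                                                *)
Definition spanned s (r : seq V) : simplex := insubd s [fset v in r]%fset.

Definition face s (i : nat) := spanned s (take i (verts s) ++ drop i.+1 (verts s)).
Definition front s (j : nat) := spanned s (take j.+1 (verts s)).
Definition back s (j : nat) := spanned s (drop j (verts s)).

Lemma spanned_le s r : {subset r <= verts s} -> sle (spanned s r) s.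
Proof.
move=> rs; rewrite /sle /spanned val_insubd; case: ifP => _; last exact: fsubset_refl.
by apply/fsubsetP => v; rewrite !inE => /rs; rewrite mem_sort.
Qed.
Lemma size_verts s : size (verts s) = (sdim s).+1.
Proof.
rewrite /verts size_sort /sdim prednK //.
rewrite cardfs_gt0; apply: contraTneq (valP s) => ->; exact: faces_neq0.
Qed.
Lemma verts_spanned s r : r != [::] -> subseq r (verts s) ->
  \val (spanned s r) = [fset v in r]%fset /\ verts (spanned s r) = r.
Proof.
move=> r0 rs.
have sub : ([fset v in r] `<=` \val s)%fset.
  by apply/fsubsetP => v; rewrite !inE => /(mem_subseq rs); rewrite mem_sort.
have rX : [fset v in r]%fset \in faces X.
  apply: (faces_sub (valP s)) => //.
  by case: r r0 {rs sub} => // v r _; apply/fset0Pn; exists v; rewrite !inE eqxx.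
have e : \val (spanned s r) = [fset v in r]%fset by rewrite /spanned val_insubd rX.
split=> //; rewrite /verts e.
have ur : uniq r.
  by apply: subseq_uniq rs _; rewrite /verts sort_uniq fset_uniq.
have pm : perm_eq (enum_fset [fset v in r]%fset) r.
  by apply: uniq_perm => //; move=> v; rewrite inE.
have mr v : v \in r -> v \in [fset v in r]%fset by rewrite inE.
have rs' : {subset r <= \val s} by move=> v /(mem_subseq rs); rewrite mem_sort.
apply: (@sorted_eq_in _ (vle X [fset v in r]%fset)).
- move=> y x z; rewrite !mem_sort; exact: (vle_trans rX).
- move=> x y; rewrite !mem_sort; exact: (vle_anti rX).
- apply: (@sort_sorted_in _ (mem [fset v in r]%fset)); first exact: (vle_total rX).
  exact/allP.
- have h : sorted (vle X (\val s)) r.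
    apply: (@subseq_sorted_in _ _ r (verts s)) rs _.
      move=> y x z; rewrite !mem_sort; exact: (vle_trans (valP s)).
    apply: (@sort_sorted_in _ (mem (\val s))); first exact: (vle_total (valP s)).
    exact/allP.
  apply: (@sub_in_sorted _ (mem [fset v in r]%fset) (vle X (\val s)) _ _ r) h.
    by move=> x y xr yr; rewrite (vle_sub (valP s) rX sub).
  by apply/allP.
- by rewrite perm_sort.
Qed.
Lemma face_le s i : sle (face s i) s.
Proof. by apply: spanned_le => v; rewrite mem_cat => /orP[/mem_take|/mem_drop]. Qed.
Lemma front_le s i : sle (front s i) s.
Proof. by apply: spanned_le => v /mem_take. Qed.
Lemma back_le s i : sle (back s i) s.
Proof. by apply: spanned_le => v /mem_drop. Qed.

Lemma star_fin s : finite_set [set t | sle s t].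
Proof.
have [v vs] : exists v, v \in \val s.
  apply/fset0Pn; apply: contraTneq (valP s) => ->; exact: faces_neq0.
have := finite_preimage (f := (\val : simplex -> _)) (in2W val_inj) (faces_fin X v).
apply: sub_finite_set => t st /=; split; first exact: valP.
by move/fsubsetP: st; apply.
Qed.

Lemma faces_of_fin s : finite_set [set t | sle t s].
Proof.
have := finite_preimage (f := (\val : simplex -> _)) (in2W val_inj) (finite_fset (fpowerset (\val s))).
by apply: sub_finite_set => t; rewrite /= fpowersetE.
Qed.

(* [k] is an integer; there are no [k]-simplices for [k < 0]. *)
Definition ksimplex (k : int) : Type := {s : simplex | (sdim s)%:Z == k}.
HB.instance Definition _ k := SubChoice.on (ksimplex k).

Lemma ksimplex_fin k (A : set simplex) :
  finite_set A -> finite_set [set s : ksimplex k | A (\val s)].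
Proof. exact: (finite_preimage (in2W val_inj)). Qed.

Definition star k (t : simplex) : set (ksimplex k) := [set s | sle t (\val s)].
Arguments star : clear implicits.

Lemma kstar_fin k t : finite_set (star k t).
Proof. exact: (@ksimplex_fin k [set s | sle t s] (star_fin t)). Qed.
End Simplices.

Arguments sdim {V X} s.
Arguments sle {V X} s t.
Arguments verts {V X} s.
Arguments face {V X} s i.
Arguments front {V X} s j.
Arguments back {V X} s j.
Arguments ksimplex {V} X k.
Arguments star {V X} k t _.

Section BimoduleConstructions.
Variable R : pzRingType.

Definition homSum (U V : bimodType R) n (f : 'I_n -> bimodHom U V) :
  bimodHom U V.
Proof.
apply: (@mkHom R U V (fun x => \sum_(i < n) f i x)) => [x y|a x|x a].
- by rewrite -big_split; apply: eq_bigr => i _; rewrite homfD.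
- by rewrite scaler_sumr; apply: eq_bigr => i _; rewrite homfZ.
- by rewrite rscaler_sum; apply: eq_bigr => i _; rewrite homfR.
Defined.

Definition sub_restrict (U W : bimodType R) (P : bisub U) (Q : bisub W)
  (f : bimodHom U W) (PQ : forall x, P x -> Q (f x)) :
  bimodHom (subBimod P) (subBimod Q).
Proof.
apply: (@mkHom R (subBimod P) (subBimod Q)
  (fun x => subMk Q (f (sub_val x)) (PQ _ (sub_valP x)))).
- by move=> x y; apply: sub_val_inj; rewrite subMkK sub_valD homfD sub_valD !subMkK.
- by move=> a x; apply: sub_val_inj; rewrite subMkK sub_valZ homfZ sub_valZ !subMkK.
- by move=> x a; apply: sub_val_inj; rewrite subMkK sub_valR homfR sub_valR !subMkK.
Defined.

Definition bihom_restrict (U V W : bimodType R) (P : bisub V) (Q : bisub W)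
  (f : bihom U V W) (PQ : forall u v, P v -> Q (f u v)) :
  bihom U (subBimod P) (subBimod Q).
Proof.
exists (fun u v => subMk Q (f u (sub_val v)) (PQ _ _ (sub_valP v))).
- by move=> v x y; apply: sub_val_inj; rewrite subMkK sub_valD !subMkK bihomDl.
- by move=> u x y; apply: sub_val_inj; rewrite subMkK sub_valD bihomDr sub_valD !subMkK.
- by move=> a u v; apply: sub_val_inj; rewrite subMkK sub_valZ !subMkK bihom_scale.
- by move=> u a v; apply: sub_val_inj; rewrite subMkK bihom_bal -sub_valZ.
- by move=> u v a; apply: sub_val_inj; rewrite subMkK sub_valR bihom_rscale sub_valR !subMkK.
Defined.

Section FSum.
Variables (I : choiceType) (A : set I) (U W : bimodType R).
Hypothesis fA : finite_set A.
Lemma fsumD (f g : I -> W) :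
  \sum_(i \in A) (f i + g i) = \sum_(i \in A) f i + \sum_(i \in A) g i.
Proof. exact: fsbig_split. Qed.
Lemma fsumZ a (f : I -> W) :
  \sum_(i \in A) (a *: f i) = a *: \sum_(i \in A) f i.
Proof. by rewrite !fsbig_finite // scaler_sumr. Qed.
Lemma fsumR a (f : I -> W) :
  \sum_(i \in A) (f i *:> a) = (\sum_(i \in A) f i) *:> a.
Proof. by rewrite !fsbig_finite // rscaler_sum. Qed.
End FSum.

Lemma fsum_neq0 (I : choiceType) (A : set I) (W : bimodType R) (f : I -> W) :
  \sum_(i \in A) f i != 0 -> exists2 i, A i & f i != 0.
Proof.
apply: contra_neqP => h; apply: fsbig1 => i Ai.
by apply: contra_notP h => /eqP fi; exists i.
Qed.

Lemma sum_neq0 n (P : pred 'I_n) (W : bimodType R) (f : 'I_n -> W) :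
  \sum_(i < n | P i) f i != 0 -> exists2 i, P i & f i != 0.
Proof.
apply: contra_neqP => h; apply: big1 => i Pi.
by apply: contra_notP h => /eqP fi; exists i.
Qed.
End BimoduleConstructions.

Section Sheaves.
Variables (R : pzRingType) (V : choiceType) (X : lfComplex V).

Record sheaf := Sheaf {
  sh_ob :> simplex X -> bimodType R;
  sh_map : forall s t, sle s t -> bimodHom (sh_ob s) (sh_ob t);
  sh_id : forall s (h : sle s s) x, sh_map h x = x;
  sh_comp : forall s t u (st : sle s t) (tu : sle t u) (su : sle s u) x,
    sh_map tu (sh_map st x) = sh_map su x }.

Record cosheaf := Cosheaf {
  co_ob :> simplex X -> bimodType R;
  co_map : forall s t, sle s t -> bimodHom (co_ob t) (co_ob s);
  co_id : forall s (h : sle s s) x, co_map h x = x;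
  co_comp : forall s t u (st : sle s t) (tu : sle t u) (su : sle s u) x,
    co_map st (co_map tu x) = co_map su x }.

(* The structure maps of sheaves and cosheaves, extended by zero to pairs of  *)
(* simplices that are not nested.                                             *)
Definition res (F : sheaf) s t : bimodHom (F s) (F t) :=
  if pselect (sle s t) is left h then sh_map F h else hom0 _ _.
Definition cores (G : cosheaf) t s : bimodHom (G t) (G s) :=
  if pselect (sle s t) is left h then co_map G h else hom0 _ _.

Definition const_sheaf : sheaf :=
  @Sheaf (fun=> R^o) (fun _ _ _ => homId R^o) (fun _ _ _ => erefl)
    (fun _ _ _ _ _ _ _ => erefl).
Definition const_cosheaf : cosheaf :=
  @Cosheaf (fun=> R^o) (fun _ _ _ => homId R^o) (fun _ _ _ => erefl)
    (fun _ _ _ _ _ _ _ => erefl).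

Section Families.
Variables (F : simplex X -> bimodType R) (k : int).
Definition fam : bimodType R := @dprod R (ksimplex X k) (fun s => F (\val s)).
Definition famc : bimodType R := @dsum R (ksimplex X k) (fun s => F (\val s)).
Definition famfin : bisub fam := @finsupp R (ksimplex X k) (fun s => F (\val s)).

(* The value of [x] at an arbitrary simplex, zero if it is not a [k]-simplex *)
Definition val_at (x : fam) (s : simplex X) : F s :=
  if pselect ((sdim s)%:Z == k) is left h then x (exist _ s h) else 0.

Lemma at_val (x : fam) (s : ksimplex X k) : val_at x (\val s) = x s.
Proof.
case: s => s hs; rewrite /val_at /=; case: pselect => // h.
by rewrite (bool_irrelevance h hs).
Qed.
Lemma at_D (x y : fam) s : val_at (x + y) s = val_at x s + val_at y s.
Proof. by rewrite /val_at; case: pselect => // _; rewrite addr0. Qed.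
Lemma at_Z a (x : fam) s : val_at (a *: x) s = a *: val_at x s.
Proof. by rewrite /val_at; case: pselect => // _; rewrite scaler0. Qed.
Lemma at_R (x : fam) a s : val_at (x *:> a) s = val_at x s *:> a.
Proof. by rewrite /val_at; case: pselect => // _; rewrite rscale0r. Qed.

Lemma at_supp (x : fam) s : val_at x s != 0 ->
  exists2 t : ksimplex X k, x t != 0 & \val t = s.
Proof.
by rewrite /val_at; case: pselect => [h xs|_ /eqP//]; exists (exist _ s h).
Qed.
End Families.

Section Cochains.
Variables (F : sheaf) (l : int).

Definition cobd_fun (x : fam F l) : fam F (l + 1) := fun s =>
  \sum_(i < (sdim (\val s)).+1)
    res F (face (\val s) i) (\val s) (val_at x (face (\val s) i)) *~ (-1) ^+ i.

Definition cobd : bimodHom (fam F l) (fam F (l + 1)).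
Proof.
apply: (@mkHom R _ _ cobd_fun).
- move=> x y; apply: dprod_ext => s.
  rewrite dprodDE /cobd_fun -big_split; apply: eq_bigr => i _ /=.
  by rewrite at_D homfD mulrzDl.
- move=> a x; apply: dprod_ext => s.
  rewrite dprodZE /cobd_fun scaler_sumr; apply: eq_bigr => i _ /=.
  by rewrite at_Z homfZ scalerMzr.
- move=> x a; apply: dprod_ext => s.
  rewrite dprodRE /cobd_fun rscaler_sum; apply: eq_bigr => i _ /=.
  by rewrite at_R homfR rscalerMz.
Defined.

Fact cobd_fin x : famfin F l x -> famfin F (l + 1) (cobd x).
Proof.
move=> fx.
have : finite_set (\bigcup_(t in supp x) star (l + 1) (\val t)).
  by apply: bigcup_finite => // t _; apply: kstar_fin.
apply: sub_finite_set => s /=; rewrite /supp /=.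
case/sum_neq0 => i _; have [->|/at_supp[t xt ts] _] := eqVneq (val_at x (face (\val s) i)) 0.
  by rewrite homf0 mul0rz eqxx.
by exists t => //; rewrite /star /= ts face_le.
Qed.

Definition cobdc : bimodHom (famc F l) (famc F (l + 1)) :=
  sub_restrict cobd_fin.
End Cochains.

Section Chains.
Variables (G : cosheaf) (k : int).

(* The coefficient at [t] of the boundary of [x]: [cores (x s)], with sign     *)
(* [(-1) ^+ i], for all [s] whose [i]-th face is [t].  The sum is finite.      *)
Definition bd_fun (x : fam G k) : fam G (k - 1) := fun t =>
  \sum_(s \in star k (\val t))
    \sum_(i < (sdim (\val s)).+1 | face (\val s) i == \val t)
      cores G (\val s) (\val t) (x s) *~ (-1) ^+ i.

Definition bd : bimodHom (fam G k) (fam G (k - 1)).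
Proof.
apply: (@mkHom R _ _ bd_fun).
- move=> x y; apply: dprod_ext => t.
  rewrite dprodDE /bd_fun -fsumD; last exact: kstar_fin.
  apply: eq_fsbigr => s _; rewrite -big_split; apply: eq_bigr => i _ /=.
  by rewrite homfD mulrzDl.
- move=> a x; apply: dprod_ext => t.
  rewrite dprodZE /bd_fun -fsumZ; last exact: kstar_fin.
  apply: eq_fsbigr => s _; rewrite scaler_sumr; apply: eq_bigr => i _ /=.
  by rewrite homfZ scalerMzr.
- move=> x a; apply: dprod_ext => t.
  rewrite dprodRE /bd_fun -fsumR; last exact: kstar_fin.
  apply: eq_fsbigr => s _; rewrite rscaler_sum; apply: eq_bigr => i _ /=.
  by rewrite homfR rscalerMz.
Defined.

Fact bd_fin x : famfin G k x -> famfin G (k - 1) (bd x).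
Proof.
move=> fx.
have : finite_set (\bigcup_(s in supp x) [set t : ksimplex X (k - 1) | sle (\val t) (\val s)]).
  by apply: bigcup_finite => // s _; apply/(@ksimplex_fin _ _ _ [set t | sle t (\val s)])/faces_of_fin.
apply: sub_finite_set => t /=; rewrite /supp /=.
case/fsum_neq0 => s ts /sum_neq0[i _ h]; exists s => //=.
by apply: contra_neq h => ->; rewrite homf0 mul0rz.
Qed.

Definition bdc : bimodHom (famc G k) (famc G (k - 1)) := sub_restrict bd_fin.
End Chains.
End Sheaves.

Section LocalHomology.
Variables (R : pzRingType) (V : choiceType) (X : lfComplex V).
Implicit Types s t u : simplex X.

Definition coface s (k : int) : Type :=
  {a : simplex X | ((sdim a)%:Z == k) && sle s a}.
HB.instance Definition _ s k := SubChoice.on (coface s k).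

(* [C_k(X, X - st(s); R)] and [C^k(X, X - st(s); R)] *)
Definition lchain s k : bimodType R := @dsum R (coface s k) (fun=> R^o).
Definition lcochain s k : bimodType R := @dprod R (coface s k) (fun=> R^o).

(* [sym s k a r] is [r] times the symbol of [a], zero if [a] is not in *)
(* [coface s k].                                                       *)
Definition sym s k (a : simplex X) : bimodHom R^o (lchain s k) :=
  if insub a is Some b then @dsum_in R (coface s k) (fun=> R^o) b
  else hom0 _ _.

(* The value of a relative cochain on the symbol of [a] *)
Definition lat s k (f : lcochain s k) (a : simplex X) : R^o :=
  if insub a is Some b then f b else 0.

Lemma sym_val s k (a : coface s k) r :
  sym s k (\val a) r = @dsum_in R (coface s k) (fun=> R^o) a r.
Proof. by rewrite /sym valK. Qed.
Lemma sym_le s k a r : ~~ sle s a -> sym s k a r = 0.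
Proof. by move=> h; rewrite /sym insubF //; apply: contraNF h => /andP[]. Qed.
Lemma lat_val s k f (a : coface s k) : lat f (\val a) = f a.
Proof. by rewrite /lat valK. Qed.
Lemma lat_le s k (f : lcochain s k) a : ~~ sle s a -> lat f a = 0.
Proof. by move=> h; rewrite /lat insubF //; apply: contraNF h => /andP[]. Qed.
Lemma lat_D s k (f g : lcochain s k) a : lat (f + g) a = lat f a + lat g a.
Proof. by rewrite /lat; case: insub => // *; rewrite addr0. Qed.
Lemma lat_Z s k b (f : lcochain s k) a : lat (b *: f) a = b *: lat f a.
Proof. by rewrite /lat; case: insub => // *; rewrite scaler0. Qed.
Lemma lat_R s k (f : lcochain s k) b a : lat (f *:> b) a = lat f a *:> b.
Proof. by rewrite /lat; case: insub => // *; rewrite rscale0r. Qed.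

(* The relative boundary and coboundary, meant for [j = i - 1], resp. *)
(* [j = i + 1]; having [j] as a parameter avoids casts.               *)
Definition lbd s i j : bimodHom (lchain s i) (lchain s j) :=
  dsum_lift (fun a : coface s i =>
    homSum (fun m : 'I_(sdim (\val a)).+1 =>
      homMz (sym s j (face (\val a) m)) ((-1) ^+ m))).

Definition lcobd_fun s i j (f : lcochain s i) : lcochain s j := fun a =>
  \sum_(m < (sdim (\val a)).+1) lat f (face (\val a) m) *~ (-1) ^+ m.

Definition lcobd s i j : bimodHom (lcochain s i) (lcochain s j).
Proof.
apply: (@mkHom R _ _ (@lcobd_fun s i j)).
- move=> x y; apply: dprod_ext => a.
  rewrite dprodDE /lcobd_fun -big_split; apply: eq_bigr => m _ /=.
  by rewrite lat_D mulrzDl.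
- move=> b x; apply: dprod_ext => a.
  rewrite dprodZE /lcobd_fun scaler_sumr; apply: eq_bigr => m _ /=.
  by rewrite lat_Z scalerMzr.
- move=> x b; apply: dprod_ext => a.
  rewrite dprodRE /lcobd_fun rscaler_sum; apply: eq_bigr => m _ /=.
  by rewrite lat_R rscalerMz.
Defined.

Lemma lbd_in s i j (a : coface s i) r :
  lbd s i j (@dsum_in R _ _ a r) =
  \sum_(m < (sdim (\val a)).+1) sym s j (face (\val a) m) r *~ (-1) ^+ m.
Proof. by rewrite /lbd dsum_lift_in. Qed.

Lemma hom_lchain_ext s k (U : bimodType R) (f g : bimodHom (lchain s k) U) :
  (forall (a : coface s k) r,
    f (@dsum_in R _ (fun=> R^o) a r) = g (@dsum_in R _ (fun=> R^o) a r)) ->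
  forall c, f c = g c.
Proof.
move=> fg; elim/dsum_ind; first by rewrite !homf0.
  by move=> x y hx hy; rewrite !homfD hx hy.
by move=> a r; apply: fg.
Qed.

(* The symbol of [a] over [s] is sent to the symbol of [a] over [t]. *)
Definition push s t k : bimodHom (lchain s k) (lchain t k) :=
  dsum_lift (fun a : coface s k => sym t k (\val a)).

(* The dual symbol of [a] over [t] is sent to the dual symbol of [a] over [s]. *)
Definition pull_fun s t k (f : lcochain t k) : lcochain s k :=
  fun a => lat f (\val a).
Definition pull s t k : bimodHom (lcochain t k) (lcochain s k).
Proof.
apply: (@mkHom R _ _ (@pull_fun s t k)).
- by move=> x y; apply: dprod_ext => a; apply: lat_D.
- by move=> b x; apply: dprod_ext => a; apply: lat_Z.
- by move=> x b; apply: dprod_ext => a; apply: lat_R.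
Defined.

Lemma push_sym s t k a r : sle s t -> push s t k (sym s k a r) = sym t k a r.
Proof.
move=> st; rewrite {1}/sym; case: insubP => [b _ <-|]; first by rewrite [LHS]dsum_lift_in.
rewrite homf0 /sym => h; rewrite insubF //; apply: contraNF h => /andP[->] /=.
exact: sle_trans.
Qed.

Lemma lat_pull s t k f a : sle s t -> lat (pull s t k f) a = lat f a.
Proof.
move=> st; rewrite {1}/lat; case: insubP => [b _ <-|h] //.
rewrite /lat insubF //; apply: contraNF h => /andP[->] /=.
exact: sle_trans.
Qed.

Lemma push_lbd s t i j c : sle s t ->
  push s t j (lbd s i j c) = lbd t i j (push s t i c).
Proof.
move=> st; apply: (@hom_lchain_ext s i _ (homComp (push s t j) (lbd s i j))
  (homComp (lbd t i j) (push s t i))) => a r.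
rewrite !homCompE lbd_in homf_sum -sym_val push_sym // /sym; case: insubP => [b _ ba|h].
  rewrite lbd_in ba; apply: eq_bigr => m _.
  by rewrite homfMz push_sym.
rewrite homf0 big1 // => m _; rewrite homfMz push_sym // sym_le ?mul0rz //.
apply: contra h => h; rewrite (sle_trans h (face_le _ _)) andbT.
by have /andP[] := valP a.
Qed.

Lemma pull_lcobd s t i j f : sle s t ->
  pull s t j (lcobd t i j f) = lcobd s i j (pull s t i f).
Proof.
move=> st; apply: dprod_ext => a /=; rewrite /pull_fun /lat.
case: insubP => [b _ ba|h].
  by rewrite /lcobd_fun ba; apply: eq_bigr => m _; rewrite (lat_pull _ _ st).
rewrite /lcobd_fun big1 // => m _; rewrite (lat_pull _ _ st) lat_le ?mul0rz //.
apply: contra h => h; rewrite (sle_trans h (face_le _ _)) andbT.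
by have /andP[] := valP a.
Qed.

Variable n : int.

Definition locH s : bimodType R := homology (lbd s (n + 1) n) (lbd s n (n - 1)).
Definition locC s : bimodType R :=
  homology (lcobd s (n - 1) n) (lcobd s n (n + 1)).

Definition locH_map s t (st : sle s t) : bimodHom (locH s) (locH t) :=
  hmap (fun c => @push_lbd s t (n + 1) n c st) (fun c => @push_lbd s t n (n - 1) c st).
Definition locC_map s t (st : sle s t) : bimodHom (locC t) (locC s) :=
  hmap (fun f => @pull_lcobd s t (n - 1) n f st) (fun f => @pull_lcobd s t n (n + 1) f st).

Lemma push_id s k c : push s s k c = c.
Proof.
apply: (@hom_lchain_ext s k _ (push s s k) (homId _)) => a r.
by rewrite -sym_val push_sym ?sle_refl.
Qed.
Lemma push_comp s t u k c : sle s t -> sle t u ->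
  push t u k (push s t k c) = push s u k c.
Proof.
move=> st tu; apply: (@hom_lchain_ext s k _
  (homComp (push t u k) (push s t k)) (push s u k)) => a r.
by rewrite !homCompE -sym_val !push_sym ?(sle_trans st tu).
Qed.
Lemma pull_id s k f : pull s s k f = f.
Proof. by apply: dprod_ext => a; apply: lat_val. Qed.
Lemma pull_comp s t u k f : sle s t -> sle t u ->
  pull s t k (pull t u k f) = pull s u k f.
Proof. by move=> st tu; apply: dprod_ext => a; apply: lat_pull. Qed.

Fact locH_id s (h : sle s s) x : locH_map h x = x.
Proof.
elim/hclass_ind: x => c gc.
have gc' : lbd s n (n - 1) (push s s n c) = 0 by rewrite push_id.
by rewrite [LHS](hmapE _ _ _ gc'); apply: hclass_ext; apply: push_id.
Qed.
Fact locH_comp s t u (st : sle s t) (tu : sle t u) (su : sle s u) x :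
  locH_map tu (locH_map st x) = locH_map su x.
Proof.
elim/hclass_ind: x => c gc.
have gt : lbd t n (n - 1) (push s t n c) = 0 by rewrite -push_lbd // gc homf0.
have gu : lbd u n (n - 1) (push s u n c) = 0 by rewrite -push_lbd // gc homf0.
have gu' : lbd u n (n - 1) (push t u n (push s t n c)) = 0.
  by rewrite push_comp.
rewrite [X in locH_map tu X](hmapE _ _ _ gt) [LHS](hmapE _ _ _ gu').
by rewrite [RHS](hmapE _ _ _ gu); apply: hclass_ext; apply: push_comp.
Qed.
Definition locH_sheaf : sheaf R X := Sheaf locH_id locH_comp.

Fact locC_id s (h : sle s s) x : locC_map h x = x.
Proof.
elim/hclass_ind: x => c gc.
have gc' : lcobd s n (n + 1) (pull s s n c) = 0 by rewrite pull_id.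
by rewrite [LHS](hmapE _ _ _ gc'); apply: hclass_ext; apply: pull_id.
Qed.
Fact locC_comp s t u (st : sle s t) (tu : sle t u) (su : sle s u) x :
  locC_map st (locC_map tu x) = locC_map su x.
Proof.
elim/hclass_ind: x => c gc.
have gt : lcobd t n (n + 1) (pull t u n c) = 0 by rewrite -pull_lcobd // gc homf0.
have gu : lcobd s n (n + 1) (pull s u n c) = 0 by rewrite -pull_lcobd // gc homf0.
have gu' : lcobd s n (n + 1) (pull s t n (pull t u n c)) = 0.
  by rewrite pull_comp.
rewrite [X in locC_map st X](hmapE _ _ _ gt) [LHS](hmapE _ _ _ gu').
by rewrite [RHS](hmapE _ _ _ gu); apply: hclass_ext; apply: pull_comp.
Qed.
Definition locC_cosheaf : cosheaf R X := Cosheaf locC_id locC_comp.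

(* Evaluation of relative cochains on relative chains, with values in [R] *)
Definition eval s k (f : lcochain s k) (c : lchain s k) : R^o :=
  \sum_(a \in [set: coface s k]) (f a : R) * (dsum_coef c a : R).

Lemma evalE s k f (c : lchain s k) (A : set (coface s k)) :
  supp (dsum_coef c) `<=` A ->
  eval f c = \sum_(a \in A) (f a : R) * (dsum_coef c a : R).
Proof.
move=> sA; apply/esym/fsbig_widen => // a [_ /= nA].
have [->|h] := eqVneq (dsum_coef c a) 0; first exact: mulr0.
by case: nA; apply: sA.
Qed.
Lemma evalDl s k (c : lchain s k) : {morph (fun f => eval f c) : f g / f + g}.
Proof.
move=> f g; rewrite !(evalE _ (@subset_refl _ (supp (dsum_coef c)))).
rewrite -fsumD; last exact: dsum_fin.
by apply: eq_fsbigr => a _; rewrite mulrDl.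
Qed.
Lemma evalDr s k (f : lcochain s k) : {morph eval f : c c' / c + c'}.
Proof.
move=> c c'; set A := supp (dsum_coef c) `|` supp (dsum_coef c').
have fA : finite_set A by rewrite finite_setU; split; exact: dsum_fin.
rewrite (@evalE s k f c A) ?(@evalE s k f c' A) ?(@evalE s k f (c + c') A).
- by rewrite -fsumD //; apply: eq_fsbigr => a _; rewrite dsum_coefD mulrDr.
- move=> i; rewrite /A /supp /= dsum_coefD.
  have [->|] := eqVneq (dsum_coef c i) 0; last by left.
  by rewrite add0r; right.
- by move=> i; right.
- by move=> i; left.
Qed.
Lemma evalZ s k b f (c : lchain s k) : eval (b *: f) c = b *: eval f c.
Proof.
rewrite !(evalE _ (@subset_refl _ (supp (dsum_coef c)))).
rewrite -fsumZ; last exact: dsum_fin.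
by apply: eq_fsbigr => a _; exact: esym (mulrA b (f a : R) (dsum_coef c a : R)).
Qed.
Lemma eval_bal s k f b (c : lchain s k) : eval (f *:> b) c = eval f (b *: c).
Proof.
rewrite !(@evalE _ _ _ _ (supp (dsum_coef c))) //.
  apply: eq_fsbigr => a _; rewrite dsum_coefZ dprodRE.
  exact: esym (mulrA (f a : R) b (dsum_coef c a : R)).
by move=> a; rewrite /supp /= dsum_coefZ; apply: contra_neq => ->; rewrite scaler0.
Qed.
Lemma evalR s k f (c : lchain s k) b : eval f (c *:> b) = eval f c *:> b.
Proof.
rewrite !(@evalE _ _ _ _ (supp (dsum_coef c))) //.
  rewrite -fsumR; last exact: dsum_fin.
  apply: eq_fsbigr => a _; rewrite dsum_coefR.
  exact: (mulrA (f a : R) (dsum_coef c a : R) b).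
by move=> a; rewrite /supp /= dsum_coefR; apply: contra_neq => ->; rewrite rscale0r.
Qed.

Lemma eval0l s k (c : lchain s k) : eval 0 c = 0.
Proof. by apply: (addrI (eval 0 c)); rewrite -evalDl !addr0. Qed.
Lemma eval0r s k (f : lcochain s k) : eval f 0 = 0.
Proof. by apply: (addrI (eval f 0)); rewrite -evalDr !addr0. Qed.

Lemma eval_in s k f (a : coface s k) r :
  eval f (@dsum_in R _ (fun=> R^o) a r) = (f a : R) * (r : R).
Proof.
rewrite (@evalE s k f _ [set a]).
  by rewrite fsbig_set1 [dsum_coef _]dsum_inE diracE.
move=> b; rewrite /supp /= [dsum_coef _]dsum_inE.
by apply: contra_neqP => /eqP; rewrite eq_sym => ab; apply: dirac_neq.
Qed.
Lemma eval_sym s k f a r : eval f (sym s k a r) = (lat f a : R) * (r : R).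
Proof.
rewrite /sym /lat; case: insub => [b|]; first exact: eval_in.
by rewrite eval0r; apply/esym/mul0r.
Qed.

Lemma eval_sum s k f m (c : 'I_m -> lchain s k) :
  eval f (\sum_(i < m) c i) = \sum_(i < m) eval f (c i).
Proof. by apply: (big_morph (eval f)); [exact: evalDr | exact: eval0r]. Qed.
Lemma evalMz s k f (c : lchain s k) z : eval f (c *~ z) = eval f c *~ z.
Proof.
have evalMn m : eval f (c *+ m) = eval f c *+ m.
  by elim: m => [|m IH]; rewrite ?mulr0n ?eval0r // !mulrS evalDr IH.
have evalN x : eval f (- x) = - eval f x.
  by apply: (addrI (eval f x)); rewrite -evalDr !subrr eval0r.
by case: z => m; rewrite -?pmulrn ?NegzE ?mulrNz -?pmulrn ?evalN evalMn.
Qed.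

Lemma eval_bd s i j f c : eval (lcobd s i j f) c = eval f (lbd s j i c).
Proof.
elim/dsum_ind: c => [|x y hx hy|a r]; first by rewrite homf0 !eval0r.
  by rewrite homfD !evalDr hx hy.
rewrite lbd_in eval_in eval_sum mulr_suml; apply: eq_bigr => m _.
by rewrite evalMz eval_sym mulrzAl.
Qed.

Definition pairing_fun s (u : locC s) (v : locH s) : R^o :=
  eval (hrepr u) (hrepr v).

Lemma pairing_reprl s (u : locC s) (v : locH s) f (z : lcochain s (n - 1)) :
  hrepr u - f = lcobd s (n - 1) n z ->
  pairing_fun u v = eval f (hrepr v).
Proof.
move=> e; rewrite /pairing_fun -[hrepr u](subrK f) e evalDl eval_bd hreprP.
by rewrite eval0r add0r.
Qed.
Lemma pairing_reprr s (u : locC s) (v : locH s) c (z : lchain s (n + 1)) :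
  hrepr v - c = lbd s (n + 1) n z ->
  pairing_fun u v = eval (hrepr u) c.
Proof.
move=> e; rewrite /pairing_fun -[hrepr v](subrK c) e evalDr -eval_bd hreprP.
by rewrite eval0l add0r.
Qed.

Definition pairing s : bihom (locC s) (locH s) R^o.
Proof.
exists (@pairing_fun s).
- move=> v u u'; have [z e] := hreprD u u'.
  by rewrite (pairing_reprl _ e) evalDl.
- move=> u v v'; have [z e] := hreprD v v'.
  by rewrite (pairing_reprr _ e) evalDr.
- move=> a u v; have [z e] := hreprZ a u.
  by rewrite (pairing_reprl _ e) evalZ.
- move=> u a v; have [z e] := hreprR a u; have [z' e'] := hreprZ a v.
  by rewrite (pairing_reprl _ e) (pairing_reprr _ e') eval_bal.
- move=> u v a; have [z e] := hreprR a v.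
  by rewrite (pairing_reprr _ e) evalR.
Defined.

Lemma pairing_hclass s (f : lcochain s n) (c : lchain s n)
  (df : lcobd s n (n + 1) f = 0) (dc : lbd s n (n - 1) c = 0) :
  pairing s (hclass (lcobd s (n - 1) n) df) (hclass (lbd s (n + 1) n) dc) =
  eval f c.
Proof.
have [z e] := hreprK (lcobd s (n - 1) n) df.
have [z' e'] := hreprK (lbd s (n + 1) n) dc.
rewrite [LHS](pairing_reprl _ e) -[hrepr _](subrK c) e' evalDr -eval_bd df.
by rewrite eval0l add0r.
Qed.
End LocalHomology.

Section Complexes.
Variable R : pzRingType.

(* Complexes of bimodules, graded by the integers.  That [d \o d = 0] is not *)
(* recorded, as it plays no role in the notion of chain map.                 *)
Record chainCpx := ChainCpx {
  ch_ob :> int -> bimodType R;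
  ch_d : forall k, bimodHom (ch_ob k) (ch_ob (k - 1)) }.

Record cochainCpx := CochainCpx {
  cch_ob :> int -> bimodType R;
  cch_d : forall l, bimodHom (cch_ob l) (cch_ob (l + 1)) }.

Definition is_chain_map (A B : chainCpx) (f : forall m, bimodHom (A m) (B m)) :=
  forall m (x : A m), ch_d B m (f m x) = f (m - 1) (ch_d A m x).

Section TensorComplex.
Variables (C : chainCpx) (D : cochainCpx).

Definition tot_idx (m : int) : Type := {p : int * int | p.1 - p.2 == m}.
HB.instance Definition _ m := SubChoice.on (tot_idx m).

Definition tot_summand m (p : tot_idx m) : bimodType R :=
  tens (C (\val p).1) (D (\val p).2).

Definition tot_ob m : bimodType R := dsum (@tot_summand m).

Fact tot_idxl_subproof m (p : tot_idx m) : (\val p).1 - 1 - (\val p).2 == m - 1.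
Proof. by rewrite addrAC (eqP (valP p)). Qed.
Definition tot_idxl m (p : tot_idx m) : tot_idx (m - 1) :=
  exist _ ((\val p).1 - 1, (\val p).2) (tot_idxl_subproof p).

Fact tot_idxr_subproof m (p : tot_idx m) :
  (\val p).1 - ((\val p).2 + 1) == m - 1.
Proof. by rewrite opprD addrA (eqP (valP p)). Qed.
Definition tot_idxr m (p : tot_idx m) : tot_idx (m - 1) :=
  exist _ ((\val p).1, (\val p).2 + 1) (tot_idxr_subproof p).

Definition tot_inl m (p : tot_idx m) :
    bimodHom (tens (C ((\val p).1 - 1)) (D (\val p).2)) (tot_ob (m - 1)) :=
  dsum_in (@tot_summand (m - 1)) (tot_idxl p).
Definition tot_inr m (p : tot_idx m) :
    bimodHom (tens (C (\val p).1) (D ((\val p).2 + 1))) (tot_ob (m - 1)) :=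
  dsum_in (@tot_summand (m - 1)) (tot_idxr p).

(* x (x) y |-> d x (x) y + (-1) ^ (k - l) x (x) d y *)
Definition tot_d_summand m (p : tot_idx m) :
    bimodHom (tot_summand p) (tot_ob (m - 1)) :=
  let k := (\val p).1 in let l := (\val p).2 in
  homD
    (homComp (tot_inl p) (tens_map (ch_d C k) (homId (D l))))
    (homMz (homComp (tot_inr p) (tens_map (homId (C k)) (cch_d D l)))
      ((-1) ^ (k - l))).

Definition tot_d m : bimodHom (tot_ob m) (tot_ob (m - 1)) :=
  dsum_lift (@tot_d_summand m).

Definition tot : chainCpx := ChainCpx tot_d.

(* The map out of the tensor product complex given by balanced maps *)
(* [C_k -> D^l -> E_m], which are only used for [m = k - l].        *)
Definition tot_lift_summand (E : chainCpx)
    (f : forall k l m, bihom (C k) (D l) (E m)) m (p : tot_idx m) :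
    bimodHom (tot_summand p) (E m) :=
  tens_lift (f (\val p).1 (\val p).2 m).
Definition tot_lift (E : chainCpx) (f : forall k l m, bihom (C k) (D l) (E m))
    m : bimodHom (tot m) (E m) :=
  dsum_lift (@tot_lift_summand E f m).
End TensorComplex.
End Complexes.

Section CapProducts.
Variables (R : pzRingType) (V : choiceType) (X : lfComplex V).

Definition lfchains (G : cosheaf R X) : chainCpx R := ChainCpx (bd G).
Definition chains (G : cosheaf R X) : chainCpx R := ChainCpx (bdc G).
Definition cochains (F : sheaf R X) : cochainCpx R := CochainCpx (cobd F).
Definition cochains_c (F : sheaf R X) : cochainCpx R := CochainCpx (cobdc F).

Variable n : int.
Local Notation hn := (locH_sheaf R X n).
Local Notation hn' := (locC_cosheaf R X n).
Local Notation cR := (const_cosheaf R X).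
Local Notation sR := (const_sheaf R X).

Definition with_front k j (t : simplex X) : set (ksimplex X k) :=
  [set s | front (\val s) j = t].
Arguments with_front : clear implicits.

Lemma with_front_fin k j t : finite_set (with_front k j t).
Proof.
apply: (sub_finite_set _ (kstar_fin k t)) => s <-; exact: front_le.
Qed.

Section Caps.
Variables k l m : int.

(* The coefficients at [t] of the cap products: the sum runs over the [s] with *)
(* [k - l]-th front face [t], and is finite by local finiteness.  For          *)
(* [m = k - l < 0] there is no [t].                                            *)
Definition cap_loc_fun (x : fam hn' k) (y : fam hn l) : fam cR m := fun t =>
  \sum_(s \in with_front k `|k - l|%N (\val t))
    let r := back (\val s) `|k - l|%N in
    pairing R n r (cores hn' (\val s) r (x s)) (val_at y r).

Definition cap_const_fun (x : fam hn' k) (y : fam sR l) : fam hn' m := fun t =>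
  \sum_(s \in with_front k `|k - l|%N (\val t))
    (cores hn' (\val s) (\val t) (x s) *:> val_at y (back (\val s) `|k - l|%N)).

Definition cap_loc : bihom (fam hn' k) (fam hn l) (fam cR m).
Proof.
exists cap_loc_fun.
- move=> y x x'; apply: dprod_ext => t; rewrite dprodDE /cap_loc_fun.
  rewrite -fsumD; last exact: with_front_fin.
  by apply: eq_fsbigr => s _; rewrite homfD bihomDl.
- move=> x y y'; apply: dprod_ext => t; rewrite dprodDE /cap_loc_fun.
  rewrite -fsumD; last exact: with_front_fin.
  by apply: eq_fsbigr => s _; rewrite at_D bihomDr.
- move=> a x y; apply: dprod_ext => t; rewrite dprodZE /cap_loc_fun.
  rewrite -fsumZ; last exact: with_front_fin.
  by apply: eq_fsbigr => s _; rewrite homfZ bihom_scale.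
- move=> x a y; apply: dprod_ext => t; rewrite /cap_loc_fun.
  by apply: eq_fsbigr => s _; rewrite homfR at_Z bihom_bal.
- move=> x y a; apply: dprod_ext => t; rewrite dprodRE /cap_loc_fun.
  rewrite -fsumR; last exact: with_front_fin.
  by apply: eq_fsbigr => s _; rewrite at_R bihom_rscale.
Defined.

Definition cap_const : bihom (fam hn' k) (fam sR l) (fam hn' m).
Proof.
exists cap_const_fun.
- move=> y x x'; apply: dprod_ext => t; rewrite dprodDE /cap_const_fun.
  rewrite -fsumD; last exact: with_front_fin.
  by apply: eq_fsbigr => s _; rewrite homfD rscalerDl.
- move=> x y y'; apply: dprod_ext => t; rewrite dprodDE /cap_const_fun.
  rewrite -fsumD; last exact: with_front_fin.
  by apply: eq_fsbigr => s _; rewrite at_D rscalerDr.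
- move=> a x y; apply: dprod_ext => t; rewrite dprodZE /cap_const_fun.
  rewrite -fsumZ; last exact: with_front_fin.
  by apply: eq_fsbigr => s _; rewrite homfZ scaler_rscaler.
- move=> x a y; apply: dprod_ext => t; rewrite /cap_const_fun.
  by apply: eq_fsbigr => s _; rewrite homfR at_Z rscalerA.
- move=> x y a; apply: dprod_ext => t; rewrite dprodRE /cap_const_fun.
  rewrite -fsumR; last exact: with_front_fin.
  by apply: eq_fsbigr => s _; rewrite at_R rscalerA.
Defined.

Lemma cap_fin (F : sheaf R X) (y : fam F l) (A : set (ksimplex X m)) j :
  famfin F l y ->
  (forall t, A t -> exists2 s : ksimplex X k,
     with_front k j (\val t) s & val_at y (back (\val s) j) != 0) ->
  finite_set A.
Proof.
move=> fy h.
have : finite_set (\bigcup_(r in supp y) \bigcup_(s in star k (\val r))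
    [set t : ksimplex X m | sle (\val t) (\val s)]).
  apply: bigcup_finite => // r _; apply: bigcup_finite; first exact: kstar_fin.
  move=> s _.
  exact: (@ksimplex_fin _ _ _ [set t | sle t (\val s)] (faces_of_fin _)).
apply: sub_finite_set => t /h[s ts /at_supp[r yr rs]].
exists r => //; exists s; first by rewrite /star /= rs back_le.
by rewrite /= -ts front_le.
Qed.

Fact cap_loc_fin x y : famfin hn l y -> famfin cR m (cap_loc x y).
Proof.
move=> fy; apply: (cap_fin (j := `|k - l|%N) fy) => t ht.
have [s ts h] := fsum_neq0 ht; exists s => //.
apply: contra_neq h => e; cbv zeta; rewrite e.
exact: bihom0r.
Qed.

Fact cap_const_fin x y : famfin sR l y -> famfin hn' m (cap_const x y).
Proof.
move=> fy; apply: (cap_fin (j := `|k - l|%N) fy) => t ht.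
have [s ts h] := fsum_neq0 ht; exists s => //.
apply: contra_neq h => e; cbv zeta; rewrite e.
exact: rscaler0.
Qed.

Definition cap_loc_c : bihom (fam hn' k) (famc hn l) (famc cR m) :=
  bihom_restrict cap_loc_fin.
Definition cap_const_c : bihom (fam hn' k) (famc sR l) (famc hn' m) :=
  bihom_restrict cap_const_fin.
End Caps.

Definition cap_lf_loc m :
    bimodHom (tot (lfchains hn') (cochains hn) m) (lfchains cR m) :=
  @tot_lift R (lfchains hn') (cochains hn) (lfchains cR) cap_loc m.
Definition cap_c_loc m :
    bimodHom (tot (lfchains hn') (cochains_c hn) m) (chains cR m) :=
  @tot_lift R (lfchains hn') (cochains_c hn) (chains cR) cap_loc_c m.
Definition cap_lf_const m :
    bimodHom (tot (lfchains hn') (cochains sR) m) (lfchains hn' m) :=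
  @tot_lift R (lfchains hn') (cochains sR) (lfchains hn') cap_const m.
Definition cap_c_const m :
    bimodHom (tot (lfchains hn') (cochains_c sR) m) (chains hn' m) :=
  @tot_lift R (lfchains hn') (cochains_c sR) (chains hn') cap_const_c m.
End CapProducts.

(* Main.v *)
(* The two sides of the Leibniz rule are compared at a fixed simplex t of      *)
(* dimension p = k - l - 1.  Every term is a sum over the k-simplices s        *)
(* containing t.  In d(eta) \cap phi, the faces of s omitting a vertex i <= p  *)
(* leave the back part of s unchanged and give the terms 0, ..., p of          *)
(* d(eta \cap phi); the faces omitting a vertex i > p leave the front part     *)
(* unchanged and cancel against the terms of positive index of                 *)
(* (-1)^(k - l) eta \cap d(phi).  The remaining term of the latter, which      *)
(* omits the pivot vertex p of the back part, is the last term, of index p+1, *)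
(* of d(eta \cap phi).                                                         *)
From HB Require Import structures.
Require Import Defs.
From mathcomp Require Import all_boot all_order all_algebra finmap.
From mathcomp Require Import zify.
From mathcomp Require Import boolp classical_sets cardinality fsbigop.

Set Implicit Arguments.
Unset Strict Implicit.
Unset Printing Implicit Defensive.

Import Order.TTheory GRing.Theory.
Local Open Scope classical_set_scope.
Local Open Scope ring_scope.

(** Homomorphisms out of the total complex are determined by pure tensors, so each claim amounts to
    the Leibniz rule d(eta cap phi) = d(eta) cap phi + (-1)^(k-l) eta cap d(phi)
    ([tot_lift_chain_map]). Each of its three terms involves one structure map of a sheaf or
    cosheaf. Naturality absorbs these maps, so that at a fixed simplex [t] all terms become values
    of one function [h s b] of a [k]-simplex [s] and a face [b], lying in the module over [t]
    ([capT_leibniz]). For coefficients in [R] this is functoriality of h^n; for coefficients in h_n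
    it also uses that the maps of h^n and h_n are adjoint under evaluation ([pairing_res]). What
    remains is a signed count of faces of one ordered simplex ([simplex_leibniz]), summed over the
    finite star of [t] ([front_back_leibniz]). The versions with finite supports follow by
    restriction. *)

(** * Faces, front faces and back faces of an ordered simplex *)

Section FaceIdentities.
Variables (V : choiceType) (X : lfComplex V).
Implicit Types s t : simplex X.

(** This turns every identity between faces into one between lists of vertices. *)
Lemma verts_inj : injective (@verts V X).
Proof.
move=> s t e; apply/val_inj/fsetP => v.
have memE (u : simplex X) : (v \in \val u) = (v \in verts u).
  by rewrite /verts mem_sort.
by rewrite !memE e.
Qed.

Lemma verts_front s j : verts (front s j) = take j.+1 (verts s).
Proof.
apply: (verts_spanned _ (take_subseq _ _)).2.
by rewrite -size_eq0 size_take size_verts; case: ltnP.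
Qed.

Lemma verts_back s j : (j <= sdim s)%N -> verts (back s j) = drop j (verts s).
Proof.
move=> js; apply: (verts_spanned _ (drop_subseq _ _)).2.
by rewrite -size_eq0 size_drop size_verts subSn.
Qed.

(** On a vertex, [face s 0] takes the default value [s], hence the assumption [0 < sdim s]. *)
Lemma verts_face s i : (0 < sdim s)%N -> (i <= sdim s)%N ->
  verts (face s i) = take i (verts s) ++ drop i.+1 (verts s).
Proof.
move=> s0 js; apply: (verts_spanned _ _).2.
  rewrite -size_eq0 size_cat size_drop size_takel size_verts; lia.
rewrite -[X in subseq _ X](cat_take_drop i) cat_subseq //.
by rewrite -add1n -drop_drop drop_subseq.
Qed.

Lemma sdim_verts s : sdim s = (size (verts s)).-1.
Proof. by rewrite size_verts. Qed.

Lemma sdim_front s j : (j <= sdim s)%N -> sdim (front s j) = j.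
Proof.
by move=> js; rewrite sdim_verts verts_front size_takel // size_verts.
Qed.

Lemma sdim_back s j : (j <= sdim s)%N -> sdim (back s j) = (sdim s - j)%N.
Proof.
by move=> js; rewrite sdim_verts verts_back // size_drop size_verts subSn.
Qed.

Lemma sdim_face s i : (0 < sdim s)%N -> (i <= sdim s)%N ->
  sdim (face s i) = (sdim s).-1.
Proof.
move=> s0 js; rewrite sdim_verts verts_face //.
by rewrite size_cat size_drop size_takel size_verts; lia.
Qed.

(** Omitting a vertex [i <= p] moves the later ones down by one: position [p] of the face is
    position [p.+1] of [s]. *)
Lemma front_face_lt s i p : (i <= p < sdim s)%N ->
  front (face s i) p = face (front s p.+1) i.
Proof.
move=> /andP[ip ps]; apply: verts_inj.
rewrite verts_front !verts_face ?sdim_front ?verts_front //; try lia.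
rewrite take_cat size_takel ?size_verts; last lia.
rewrite ltnNge leqW //= take_drop.
rewrite take_takel; last lia.
by congr (_ ++ drop _ (take _ _)); lia.
Qed.

Lemma back_face_lt s i p : (i <= p < sdim s)%N ->
  back (face s i) p = back s p.+1.
Proof.
move=> /andP[ip ps]; apply: verts_inj.
rewrite verts_back ?sdim_face ?verts_face ?verts_back //; try lia.
rewrite drop_cat size_takel ?size_verts; last lia.
by rewrite ltnNge ip /= drop_drop; congr drop; lia.
Qed.

Lemma front_face_gt s i p : (p < i <= sdim s)%N ->
  front (face s i) p = front s p.
Proof.
move=> /andP[pi si]; apply: verts_inj.
rewrite !verts_front verts_face //; last lia.
by rewrite takel_cat ?take_takel // size_takel ?size_verts; lia.
Qed.

Lemma back_face_gt s i p : (p < i <= sdim s)%N ->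
  back (face s i) p = face (back s p) (i - p).
Proof.
move=> /andP[pi si]; apply: verts_inj.
rewrite verts_back ?sdim_face ?verts_face ?sdim_back ?verts_back //; try lia.
rewrite drop_cat size_takel ?size_verts; last lia.
rewrite pi drop_drop take_drop; congr (drop _ (take _ _) ++ drop _ _); lia.
Qed.

Lemma face_front_last s p : (p < sdim s)%N ->
  face (front s p.+1) p.+1 = front s p.
Proof.
move=> ps; apply: verts_inj; rewrite verts_face ?sdim_front ?verts_front //.
rewrite take_takel // drop_oversize ?cats0 // size_take size_verts.
by case: ltnP.
Qed.

Lemma face_back_first s p : (p < sdim s)%N -> face (back s p) 0 = back s p.+1.
Proof.
move=> ps; apply: verts_inj.
rewrite verts_face ?sdim_back ?verts_back ?subn_gt0 //; try lia.
by rewrite take0 drop_drop.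
Qed.
End FaceIdentities.

(** * Reindexing finite sums *)

Section FiniteSums.
Variable W : zmodType.

(** Brings sums over different sets to a common index set, where they can be compared term by
    term. *)
Lemma fsum_cond (I : choiceType) (P S : set I) (a : pred I) (F : I -> W) :
  P `<=` S -> (forall i, S i -> P i <-> a i) ->
  \sum_(i \in P) F i = \sum_(i \in S) (if a i then F i else 0).
Proof.
move=> PS Pa; rewrite -(fsbig_widen _ _ _ PS) => [|i [Si nPi] /=].
  by apply: eq_fsbigr => i /set_mem Pi; rewrite (Pa _ (PS _ Pi)).1.
by case: ifP => // ai; case: nPi; apply/Pa.
Qed.

Lemma fsumMz (I : choiceType) (P : set I) (F : I -> W) (z : int) :
  finite_set P -> (\sum_(i \in P) F i) *~ z = \sum_(i \in P) F i *~ z.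
Proof. by move=> fP; rewrite !fsbig_finite // mulrz_suml. Qed.

Lemma fsum_ord (I : choiceType) (P : set I) m (Q : pred 'I_m)
    (F : I -> 'I_m -> W) : finite_set P ->
  \sum_(i \in P) \sum_(j < m | Q j) F i j =
  \sum_(j < m | Q j) \sum_(i \in P) F i j.
Proof.
move=> fP; rewrite fsbig_finite // exchange_big; apply: eq_bigr => j _.
by rewrite fsbig_finite.
Qed.

Lemma morph_fsum (U : zmodType) (f : U -> W) (I : choiceType)
    (A : set I) (F : I -> U) :
  {morph f : x y / x + y} -> finite_set A ->
  f (\sum_(i \in A) F i) = \sum_(i \in A) f (F i).
Proof.
move=> fD fA.
have f0 : f 0 = 0 by apply: (addrI (f 0)); rewrite -fD !addr0.
by rewrite !fsbig_finite // (big_morph f fD f0).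
Qed.

Lemma morph_sumMz (U : zmodType) (f : U -> W) n (P : pred 'I_n)
    (F : 'I_n -> U) (e : 'I_n -> int) :
  {morph f : x y / x + y} ->
  f (\sum_(j < n | P j) F j *~ e j) = \sum_(j < n | P j) f (F j) *~ e j.
Proof.
move=> fD; have f0 : f 0 = 0 by apply: (addrI (f 0)); rewrite -fD !addr0.
pose g : {additive U -> W} :=
  HB.pack_for {additive U -> W} f (GRing.isNmodMorphism.Build U W f (f0, fD)).
rewrite -[f]/(g : U -> W) raddf_sum; apply: eq_bigr => j _.
by rewrite raddfMz.
Qed.

Lemma fsum_fsum_cond (I J : choiceType) (A : set I) (S : set J)
    (B : I -> set J) (c : I -> J -> bool) (F : I -> J -> W) :
  finite_set A -> finite_set S -> (forall i, A i -> B i `<=` S) ->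
  (forall i j, A i -> S j -> B i j <-> c i j) ->
  \sum_(i \in A) \sum_(j \in B i) F i j =
  \sum_(j \in S) \sum_(i \in A) (if c i j then F i j else 0).
Proof.
move=> fA fS BS Bc.
rewrite -(exchange_fsbig _ (fun i j => if c i j then F i j else 0) fA fS).
apply: eq_fsbigr => i /set_mem Ai.
by apply: fsum_cond => [|j]; [apply: BS | apply: Bc].
Qed.

(** At most one term survives; the dimension of [u] ensures that [u] occurs among the indices. *)
Lemma fsum_ksimplex1 (V : choiceType) (X : lfComplex V) (k : int)
    (P : set (ksimplex X k)) (a : pred (simplex X)) (u : simplex X)
    (G : simplex X -> W) :
  (sdim u)%:Z = k -> (forall v, P v <-> a (\val v)) ->
  \sum_(v \in P) (if u == \val v then G (\val v) else 0) =
  if a u then G u else 0.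
Proof.
move=> /eqP uk Pa; have [au|au] := boolP (a u).
  pose v : ksimplex X k := exist _ u uk.
  rewrite -(@fsbig_widen _ _ _ _ [set v]) ?fsbig_set1 /= ?eqxx //.
    by move=> _ ->; apply/Pa.
  by move=> w [_ /= wv]; case: eqP => // uw; case: wv; apply: val_inj.
apply: fsbig1 => v /Pa av; case: eqP => // uv.
by rewrite uv av in au.
Qed.
End FiniteSums.

(** * The combinatorial Leibniz rule *)

Section Leibniz.
Variables (W : zmodType) (V : choiceType) (X : lfComplex V).
Implicit Types s t : simplex X.

(** The contribution of a single [s]; as [h] is arbitrary, only indices and signs are at stake. *)
Lemma simplex_leibniz s t p (h : simplex X -> W) : (p < sdim s)%N ->
  \sum_(i < p.+2 | face (front s p.+1) i == t) h (back s p.+1) *~ (-1) ^+ i =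
  \sum_(i < (sdim s).+1 | front (face s i) p == t)
     h (back (face s i) p) *~ (-1) ^+ i +
  (if front s p == t then
     \sum_(j < (sdim (back s p)).+1) h (face (back s p) j) *~ (-1) ^+ j
   else 0) *~ (-1) ^+ p.+1.
Proof.
move=> ps; rewrite sdim_back; last exact: ltnW.
(* The faces omitting a vertex up to [p] come first. Among the other [sdim s - p], omitting vertex
   [p.+1 + i] of [s] omits vertex [i.+1] of [back s p]. *)
have -> : (sdim s).+1 = (p.+1 + (sdim s - p))%N by lia.
rewrite big_mkcond [X in _ = X + _]big_mkcond big_split_ord big_ord_recr /=.
rewrite -addrA; congr (_ + _).
  apply: eq_bigr => i _; have ip : (i <= p < sdim s)%N by rewrite -ltnS ltn_ord.
  by rewrite front_face_lt // back_face_lt.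
rewrite face_front_last //.
under eq_bigr => i _.
  have hi : (p < p.+1 + i <= sdim s)%N by have := ltn_ord i; lia.
  rewrite front_face_gt // back_face_gt //.
  have -> : (p.+1 + i - p)%N = i.+1 by lia.
  over.
case: ifP => _; last by rewrite big1 // mul0rz add0r.
(* Index 0 omits the pivot and leaves [back s p.+1], the last term on the left. Index [i.+1] has
   total sign (-1)^(p+i+2), opposite to that of vertex [p.+1 + i]. *)
rewrite big_ord_recl /= face_back_first // mulrzDl addrCA expr0 mulr1z.
rewrite -[LHS]addr0; congr (_ + _); apply/esym.
rewrite mulrz_suml -big_split big1 //= => i _.
rewrite -mulrzA -exprD.
have -> : (i.+1 + p.+1)%N = (p.+1 + i).+1 by lia.
by rewrite exprS mulN1r mulrNz subrr.
Qed.

(* With h s b the contribution of s to a cap product with a cochain evaluated *)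
(* at b, the sums are d(eta \cap phi), d(eta) \cap phi and eta \cap d(phi) at *)
(* t, respectively.                                                           *)
Lemma front_back_leibniz (k m k' : int) (p : nat) t
    (h : ksimplex X k -> simplex X -> W) :
  m = p.+1 -> k' = k - 1 -> p%:Z < k -> sdim t = p ->
  \sum_(u \in star m t) \sum_(s \in @with_front V X k p.+1 (\val u))
    \sum_(i < (sdim (\val u)).+1 | face (\val u) i == t)
      h s (back (\val s) p.+1) *~ (-1) ^+ i =
  \sum_(r \in @with_front V X k' p t) \sum_(s \in star k (\val r))
    \sum_(i < (sdim (\val s)).+1 | face (\val s) i == \val r)
      h s (back (\val r) p) *~ (-1) ^+ i +
  (\sum_(s \in @with_front V X k p t)
    \sum_(j < (sdim (back (\val s) p)).+1)
      h s (face (back (\val s) p) j) *~ (-1) ^+ j) *~ (-1) ^+ p.+1.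
Proof.
move=> mp k'k pk tp.
have ks (s : ksimplex X k) : (p < sdim (\val s))%N by have := valP s; lia.
have fS := kstar_fin k t.
rewrite (@fsum_fsum_cond _ _ _ _ _ _
    (fun (u : ksimplex X m) (s : ksimplex X k) =>
      front (\val s) p.+1 == \val u) _ _ fS); first last.
- by move=> u s _ _; split=> /eqP.
- by move=> u tu s su; apply: sle_trans tu _; rewrite -su; apply: front_le.
- exact: kstar_fin.
rewrite (@fsum_fsum_cond _ _ _ _ _ _
    (fun (r : ksimplex X k') (s : ksimplex X k) =>
      sle (\val r) (\val s)) _ _ fS); first last.
- by move=> r s _ _; split.
- move=> r rt s; apply: sle_trans; rewrite -rt; exact: front_le.
- exact: with_front_fin.
rewrite (@fsum_cond _ _ (@with_front V X k p t) (star k t)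
  (fun s : ksimplex X k => front (\val s) p == t)); first last.
- by move=> s _; split=> /eqP.
- by move=> s <-; apply: front_le.
(* All sums now run over [star k t], so [s] can be fixed. The only possible [u] is then
   [front s p.+1]. *)
rewrite fsumMz // -fsbig_split //; apply: eq_fsbigr => s _.
rewrite (@fsum_ksimplex1 _ _ _ _ _ (fun u => sle t u) (front (\val s) p.+1)
  (fun u => \sum_(i < (sdim u).+1 | face u i == t)
      h s (back (\val s) p.+1) *~ (-1) ^+ i)) ?sdim_front //.
(* For fixed [s], each [i] determines [r = face s i], so the double sum collapses to one over
   [i]. *)
have -> : \sum_(r \in @with_front V X k' p t)
   (if sle (\val r) (\val s) then
     \sum_(i < (sdim (\val s)).+1 | face (\val s) i == \val r)
      h s (back (\val r) p) *~ (-1) ^+ i else 0) =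
   \sum_(i < (sdim (\val s)).+1 | front (face (\val s) i) p == t)
     h s (back (face (\val s) i) p) *~ (-1) ^+ i.
  rewrite [RHS]big_mkcond /=.
  under [RHS]eq_bigr => i _.
    rewrite -(@fsum_ksimplex1 _ _ _ _ (@with_front V X k' p t)
      (fun r => front r p == t) _ (fun r => h s (back r p) *~ (-1) ^+ i)).
    over.
    - rewrite sdim_face; have := ks s; have /eqP := valP s; have := ltn_ord i;
        rewrite /= ?k'k; lia.
    - by move=> r; split=> /eqP.
  rewrite /= -fsum_ord; last exact: with_front_fin.
  apply: eq_fsbigr => r _; rewrite big_mkcond /=; case: ifP => // rs.
  rewrite big1 // => i _; case: eqP => // e.
  by rewrite -e face_le in rs.
apply: etrans (simplex_leibniz t (h s) (ks s)).
case: ifP => // /negP tu.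
by rewrite big1 // => i /eqP e; case: tu; rewrite -e face_le.
Qed.
End Leibniz.

(** * From the Leibniz rule to chain maps *)

Section ChainMaps.
Variable R : pzRingType.

Lemma dprodMzE (I : Type) (M : I -> bimodType R) (x : dprod M) (z : int) i :
  (x *~ z) i = x i *~ z.
Proof.
have MnE n : (x *+ n) i = x i *+ n.
  by elim: n => [|n IHn]; rewrite ?mulr0n // !mulrS dprodDE IHn.
by case: z => n; rewrite -?pmulrn ?NegzE ?mulrNz -?pmulrn -MnE.
Qed.

Lemma hom_dsum_ext (I : choiceType) (M : I -> bimodType R) (N : bimodType R)
    (f g : bimodHom (dsum M) N) :
  (forall i x, f (dsum_in M i x) = g (dsum_in M i x)) -> f =1 g.
Proof.
move=> fg; elim/dsum_ind => [|x y fgx fgy|//]; first by rewrite !homf0.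
by rewrite !homfD fgx fgy.
Qed.

Lemma hom_tens_ext (M N W : bimodType R) (f g : bimodHom (tens M N) W) :
  (forall x y, f (tensor x y) = g (tensor x y)) -> f =1 g.
Proof.
move=> fg; elim/tens_ind => [|x y fgx fgy|//]; first by rewrite !homf0.
by rewrite !homfD fgx fgy.
Qed.

Lemma tens_map_tensor (M M' N N' : bimodType R) (f : bimodHom M M')
    (g : bimodHom N N') x y :
  tens_map f g (tensor x y) = tensor (f x) (g y).
Proof. exact: tens_lift_tensor. Qed.

(** Both composites are homomorphisms, so it suffices to compare them on pure tensors of each
    summand, where the sign (-1)^(k-l) is (-1)^m. *)
Lemma tot_lift_chain_map (C E : chainCpx R) (D : cochainCpx R)
    (f : forall k l m, bihom (C k) (D l) (E m)) :
  (forall k l m x y, k - l = m ->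
    ch_d E m (f k l m x y) =
    f (k - 1) l (m - 1) (ch_d C k x) y +
    f k (l + 1) (m - 1) x (cch_d D l y) *~ (-1) ^ m) ->
  @is_chain_map R (tot C D) E (tot_lift f).
Proof.
move=> fE m; apply: (hom_dsum_ext (f := homComp (ch_d E m) (tot_lift f m))
  (g := homComp (tot_lift f (m - 1)) (tot_d C D m))) => -[[k l] klm].
pose p : tot_idx m := exist _ (k, l) klm.
apply: (hom_tens_ext
  (f := homComp (homComp (ch_d E m) (tot_lift f m)) (dsum_in _ p))
  (g := homComp (homComp (tot_lift f (m - 1)) (tot_d C D m)) (dsum_in _ p))).
move=> x y; rewrite !homCompE /tot_lift /tot_d !dsum_lift_in.
rewrite /tot_lift_summand tens_lift_tensor.
rewrite /tot_d_summand homDE homMzE !homCompE.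
rewrite !tens_map_tensor homfD homfMz !dsum_lift_in !tens_lift_tensor /=.
by rewrite (fE _ _ _ _ _ (eqP klm)) (eqP klm).
Qed.
End ChainMaps.

(** * The Leibniz rule for a general cap product *)

Section CapLeibniz.
Variables (R : pzRingType) (V : choiceType) (X : lfComplex V).
Implicit Types s t b c : simplex X.

Lemma cores_comp (G : cosheaf R X) s t u (x : G u) : sle s t -> sle t u ->
  cores G t s (cores G u t x) = cores G u s x.
Proof.
move=> st tu; rewrite /cores; case: pselect => // h1; case: pselect => // h2.
by case: pselect => [h3|/(_ (sle_trans st tu)) //]; apply: co_comp.
Qed.

Lemma val_at_cobd (F : sheaf R X) l (y : fam F l) s : (sdim s)%:Z = l + 1 ->
  val_at (cobd F l y) s =
  \sum_(i < (sdim s).+1) res F (face s i) s (val_at y (face s i)) *~ (-1) ^+ i.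
Proof.
move=> /eqP sl; exact: (at_val (cobd F l y) (exist _ s sl)).
Qed.

Lemma fam_neg_eq0 (F : sheaf R X) l (y : fam F l) : l < 0 -> y = 0.
Proof. by move=> l0; apply: dprod_ext => s; have /eqP := valP s; lia. Qed.

(* The term of the cap product at t contributed by s, whose back face is b: *)
(* T t x y = <h^n(s > b) x, y> for coefficients in h_n, and                 *)
(* T t x y = h^n(s > t) x * y for coefficients in R.                        *)
Variables (G H : cosheaf R X) (F : sheaf R X).
Variable T : forall s t b, G s -> F b -> H t.
Hypothesis TDl : forall s t b (y : F b),
  {morph (fun x : G s => T t x y) : x x' / x + x'}.
Hypothesis TDr : forall s t b (x : G s),
  {morph (fun y : F b => T t x y) : y y' / y + y'}.
Hypothesis cores_T : forall s u t b (x : G s) (y : F b), sle t u -> sle u s ->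
  cores H u t (T u x y) = T t x y.
Hypothesis T_cores : forall s r t b (x : G s) (y : F b), sle r s -> sle t r ->
  sle b r -> T t (cores G s r x) y = T t x y.
Hypothesis T_res : forall s t b c (x : G s) (y : F c), sle t s -> sle b s ->
  sle c b -> T t x (res F c b y) = T t x y.

Definition capT (k l m : int) (x : fam G k) (y : fam F l) : fam H m :=
  fun t : ksimplex X m =>
  \sum_(s \in @with_front V X k `|k - l|%N (\val t))
    T (\val t) (x s) (val_at y (back (\val s) `|k - l|%N)).
Arguments capT : clear implicits.

(** Each compatibility removes the structure map from one term: [cores_T] from the boundary of the
    cap, [T_cores] from the cap with the boundary, [T_res] from the cap with the coboundary. *)
Lemma capT_leibniz (k l m : int) (x : fam G k) (y : fam F l) : k - l = m ->
  bd H m (capT k l m x y) =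
  capT (k - 1) l (m - 1) (bd G k x) y +
  capT k (l + 1) (m - 1) x (cobd F l y) *~ (-1) ^ m.
Proof.
move=> klm.
have T0 s t b (z : G s) : T t z (0 : F b) = 0.
  by apply: (addrI (T t z (0 : F b))); rewrite -TDr !addr0.
have capT0 k0 l0 m0 (x0 : fam G k0) : capT k0 l0 m0 x0 (0 : fam F l0) = 0.
  apply: dprod_ext => t; apply: fsbig1 => s _.
  by rewrite /val_at; case: pselect => // h; rewrite T0.
(* For [l < 0] everything vanishes. Otherwise [p < k] below, as the comparison of faces requires. *)
have [l0|l0] := ltP l 0.
  by rewrite (fam_neg_eq0 y l0) capT0 !homf0 !capT0 mul0rz addr0.
apply: dprod_ext => t; rewrite dprodDE.
have tm := eqP (valP t).
set p := sdim (\val t) in tm.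
(* The existence of [t] makes [m] positive, so the absolute values are the differences themselves:
   the cap on the left splits [s] at [p.+1], the other two at [p]. *)
have mp : m = p.+1 by lia.
have kl0 : `|k - l|%N = p.+1 by lia.
have kl1 : `|(k - 1 - l)%R|%N = p by lia.
have kl2 : `|(k - (l + 1))%R|%N = p by lia.
have ks (s : ksimplex X k) : (p < sdim (\val s))%N by have /eqP := valP s; lia.
pose h (s : ksimplex X k) b := T (\val t) (x s) (val_at y b).
have -> : bd H m (capT k l m x y) t =
    \sum_(u \in star m (\val t)) \sum_(s \in @with_front V X k p.+1 (\val u))
      \sum_(i < (sdim (\val u)).+1 | face (\val u) i == \val t)
        h s (back (\val s) p.+1) *~ (-1) ^+ i.
  apply: eq_fsbigr => u /set_mem tu.
  have -> : cores H (\val u) (\val t) (capT k l m x y u) =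
      \sum_(s \in @with_front V X k p.+1 (\val u)) h s (back (\val s) p.+1).
    rewrite /capT kl0 (morph_fsum _ (homfD _)); last exact: with_front_fin.
    apply: eq_fsbigr => s /set_mem su; apply: cores_T => //.
    by rewrite -su front_le.
  rewrite fsum_ord; last exact: with_front_fin.
  by apply: eq_bigr => i _; rewrite fsumMz //; exact: with_front_fin.
have -> : capT (k - 1) l (m - 1) (bd G k x) y t =
    \sum_(r \in @with_front V X (k - 1) p (\val t)) \sum_(s \in star k (\val r))
      \sum_(i < (sdim (\val s)).+1 | face (\val s) i == \val r)
        h s (back (\val r) p) *~ (-1) ^+ i.
  rewrite /capT kl1; apply: eq_fsbigr => r /set_mem rt.
  rewrite [bd G k x r]/(bd_fun x r) (morph_fsum _ (@TDl _ _ _ _)); last first.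
    exact: kstar_fin.
  apply: eq_fsbigr => s /set_mem rs.
  rewrite (morph_sumMz _ _ _ (@TDl _ _ _ _)); apply: eq_bigr => i _.
  by rewrite T_cores ?back_le // -rt front_le.
have -> : (capT k (l + 1) (m - 1) x (cobd F l y) *~ (-1) ^ m) t =
    (\sum_(s \in @with_front V X k p (\val t))
    \sum_(j < (sdim (back (\val s) p)).+1)
      h s (face (back (\val s) p) j) *~ (-1) ^+ j) *~ (-1) ^+ p.+1.
  have -> : (-1) ^ m = (-1) ^+ p.+1 :> int by rewrite mp.
  rewrite dprodMzE /capT kl2; congr (_ *~ _).
  apply: eq_fsbigr => s /set_mem st; rewrite val_at_cobd; last first.
    have /eqP := valP s; have := ks s.
    by rewrite sdim_back ?(ltnW (ks s)) //=; lia.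
  rewrite (morph_sumMz _ _ _ (@TDr _ _ _ _)); apply: eq_bigr => j _.
  by rewrite T_res ?back_le ?face_le // -st front_le.
apply: (front_back_leibniz h mp erefl) => //; lia.
Qed.
End CapLeibniz.

(** * Restriction to finite supports *)

Section Restrictions.
Variable R : pzRingType.

Lemma sub_valMz (M : bimodType R) (P : bisub M) (x : subBimod P) (z : int) :
  sub_val (x *~ z) = sub_val x *~ z.
Proof. exact: (homfMz (sub_hom P)). Qed.

Lemma sub_val_restrict (U W : bimodType R) (P : bisub U) (Q : bisub W)
    (f : bimodHom U W) (PQ : forall x, P x -> Q (f x)) x :
  sub_val (sub_restrict PQ x) = f (sub_val x).
Proof. exact: subMkK. Qed.

Lemma sub_val_bihom_restrict (U V W : bimodType R) (P : bisub V) (Q : bisub W)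
    (f : bihom U V W) (PQ : forall u v, P v -> Q (f u v)) u v :
  sub_val (bihom_restrict PQ u v) = f u (sub_val v).
Proof. exact: subMkK. Qed.
End Restrictions.

(** * The four cap products *)

Section CapChainMaps.
Variables (R : pzRingType) (V : choiceType) (X : lfComplex V) (n : int).
Local Notation hn := (locH_sheaf R X n).
Local Notation hn' := (locC_cosheaf R X n).
Local Notation cR := (const_cosheaf R X).
Local Notation sR := (const_sheaf R X).
Implicit Types s t b : simplex X.

(** On the symbol of [a] both sides read off the coefficient of [f] at [a], which is zero unless [a]
    contains [t]. *)
Lemma eval_pull s t k (f : lcochain R t k) (c : lchain R s k) : sle s t ->
  eval (pull R s t k f) c = eval f (push R s t k c).
Proof.
move=> st; elim/dsum_ind: c => [|c c' fc fc'|a r].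
- by rewrite homf0 !eval0r.
- by rewrite homfD !evalDr fc fc'.
rewrite -sym_val push_sym // !eval_sym; congr (_ * _); exact: lat_pull.
Qed.

(** The adjunction [eval_pull], passed to classes; it supplies [T_res] for coefficients in h_n. *)
Lemma pairing_res s t (u : locC R n t) (v : locH R n s) : sle s t ->
  pairing R n t u (res hn s t v) = pairing R n s (cores hn' t s u) v.
Proof.
move=> st; rewrite /res /cores; case: pselect => // h.
elim/hclass_ind: u => f df; elim/hclass_ind: v => c dc.
have dc' : lbd R t n (n - 1) (push R s t n c) = 0.
  by rewrite -push_lbd // dc homf0.
have df' : lcobd R s n (n + 1) (pull R s t n f) = 0.
  by rewrite -pull_lcobd // df homf0.
rewrite [X in pairing R n t _ X](hmapE _ _ _ dc') pairing_hclass.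
rewrite [X in pairing R n s X _](hmapE _ _ _ df') pairing_hclass.
by rewrite eval_pull.
Qed.

Lemma cap_loc_leibniz (k l m : int) (x : fam hn' k) (y : fam hn l) :
  k - l = m ->
  bd cR m (cap_loc R X n k l m x y) =
  cap_loc R X n (k - 1) l (m - 1) (bd hn' k x) y +
  cap_loc R X n k (l + 1) (m - 1) x (cobd hn l y) *~ (-1) ^ m.
Proof.
(* [cap_loc] is [capT] for this [T] by conversion; the maps of the constant cosheaf are identities,
   so [t] does not enter. *)
apply: (@capT_leibniz _ _ _ hn' cR hn
  (fun s t b u v => pairing R n b (cores hn' s b u) v)).
- by move=> s t b v u u'; rewrite homfD bihomDl.
- by move=> s t b u v v'; rewrite bihomDr.
- by move=> s u t b z v tu _; rewrite /cores; case: pselect.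
- by move=> s r t b z v rs _ br; rewrite cores_comp.
- by move=> s t b c z v _ bs cb; rewrite pairing_res // cores_comp.
Qed.

Lemma cap_const_leibniz (k l m : int) (x : fam hn' k) (y : fam sR l) :
  k - l = m ->
  bd hn' m (cap_const R X n k l m x y) =
  cap_const R X n (k - 1) l (m - 1) (bd hn' k x) y +
  cap_const R X n k (l + 1) (m - 1) x (cobd sR l y) *~ (-1) ^ m.
Proof.
apply: (@capT_leibniz _ _ _ hn' hn' sR
  (fun s t b u v => cores hn' s t u *:> (v : R))).
- by move=> s t b v u u'; rewrite homfD rscalerDl.
- by move=> s t b u v v'; rewrite rscalerDr.
- by move=> s u t b z v tu us; rewrite homfR cores_comp.
- by move=> s r t b z v rs tr _; rewrite cores_comp.
- by move=> s t b c z v _ _ cb; rewrite /res; case: pselect.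
Qed.

(** All maps are restrictions of those in [cap_loc_leibniz], and [sub_val] is injective. *)
Lemma cap_loc_c_leibniz (k l m : int) (x : fam hn' k) (y : famc hn l) :
  k - l = m ->
  bdc cR m (cap_loc_c R X n k l m x y) =
  cap_loc_c R X n (k - 1) l (m - 1) (bd hn' k x) y +
  cap_loc_c R X n k (l + 1) (m - 1) x (cobdc hn l y) *~ (-1) ^ m.
Proof.
move=> klm; apply: sub_val_inj.
rewrite sub_valD sub_valMz sub_val_restrict !sub_val_bihom_restrict.
rewrite sub_val_restrict; exact: cap_loc_leibniz.
Qed.

Lemma cap_const_c_leibniz (k l m : int) (x : fam hn' k) (y : famc sR l) :
  k - l = m ->
  bdc hn' m (cap_const_c R X n k l m x y) =
  cap_const_c R X n (k - 1) l (m - 1) (bd hn' k x) y +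
  cap_const_c R X n k (l + 1) (m - 1) x (cobdc sR l y) *~ (-1) ^ m.
Proof.
move=> klm; apply: sub_val_inj.
rewrite sub_valD sub_valMz sub_val_restrict !sub_val_bihom_restrict.
rewrite sub_val_restrict; exact: cap_const_leibniz.
Qed.
End CapChainMaps.

Theorem proposition2p11 (R : pzRingType) (V : choiceType) (X : lfComplex V)
    (n : int) :
  let h_n := locH_sheaf R X n in
  let h'n := locC_cosheaf R X n in
  let Rsh := const_sheaf R X in
  let Rco := const_cosheaf R X in
  [/\ @is_chain_map R (tot (lfchains h'n) (cochains h_n)) (lfchains Rco)
        (@cap_lf_loc R V X n),
      @is_chain_map R (tot (lfchains h'n) (cochains_c h_n)) (chains Rco)
        (@cap_c_loc R V X n),
      @is_chain_map R (tot (lfchains h'n) (cochains Rsh)) (lfchains h'n)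
        (@cap_lf_const R V X n)
    & @is_chain_map R (tot (lfchains h'n) (cochains_c Rsh)) (chains h'n)
        (@cap_c_const R V X n)].
Proof.
move=> hn hn' sR cR; split; apply: tot_lift_chain_map => k l m x y.
- exact: cap_loc_leibniz.
- exact: cap_loc_c_leibniz.
- exact: cap_const_leibniz.
- exact: cap_const_c_leibniz.
Qed.
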